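(* Let $n\ge 1$ and let $\Omega$ be an open subset of $\mathbb{R}^n$. Suppose $u(x,t)$ is a $C^{2,1}$ nonnegative solution of $$0\le u_t-\Delta u\le (u+1)^{1+2/n}\quad\text{in}\quad \Omega\times(0,1).$$ Then, for each compact subset $K$ of $\Omega$, $$\max_{x\in K}u(x,t)=O(t^{-n/2})\quad\text{as}\quad t\to 0^+.$$
   Context: $u=u(x,t)$ is a real-valued function; $u_t$ is the partial derivative in $t$ and $\Delta$ is the Laplacian in the spatial variable $x\in\mathbb{R}^n$. $C^{2,1}$ means that $u$, its first and second order partial derivatives in $x$, and its first order partial derivative in $t$ exist and are continuous on the domain of $u$, here $\Omega\times(0,1)$. No boundary conditions are imposed on $u$. *)

(* Defs.v *)
From HB Require Import structures.
From mathcomp Require Import all_boot all_order all_algebra.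
From mathcomp Require Import all_classical all_reals all_analysis.

Set Implicit Arguments.
Unset Strict Implicit.
Unset Printing Implicit Defensive.

Import Order.TTheory GRing.Theory Num.Theory.
Import numFieldNormedType.Exports.

Local Open Scope classical_set_scope.
Local Open Scope ring_scope.

Definition dirx {R : realType} {n : nat} (i : 'I_n) : 'rV[R]_n * R :=
  (delta_mx 0 i, 0).

Definition dirt {R : realType} {n : nat} : 'rV[R]_n * R := (0, 1).

Definition partialx {R : realType} {n : nat} (i : 'I_n)
    (u : 'rV[R]_n * R -> R) : 'rV[R]_n * R -> R :=
  'D_(dirx i) u.

Definition partialt {R : realType} {n : nat}
    (u : 'rV[R]_n * R -> R) : 'rV[R]_n * R -> R :=
  'D_dirt u.

Lemma partialxE (R : realType) (n : nat) (i : 'I_n) (u : 'rV[R]_n * R -> R)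
    (x : 'rV[R]_n) (t : R) :
  partialx i u (x, t) = 'D_(delta_mx 0 i) (fun y => u (y, t)) x.
Proof.
rewrite /partialx /derive.
set f := (X in lim (X @ _)); set g := (X in _ = lim (X @ _)).
suff -> : f = g by [].
apply/funext => h; rewrite /f /g /=; congr (_ *: (u (_, _) - _)).
by rewrite /= scaler0 add0r.
Qed.

Lemma partialtE (R : realType) (n : nat) (u : 'rV[R]_n * R -> R)
    (x : 'rV[R]_n) (t : R) :
  partialt u (x, t) = derive1 (fun s => u (x, s)) t.
Proof.
rewrite /partialt /derive /derive1.
set f := (X in lim (X @ _)); set g := (X in _ = lim (X @ _)).
suff -> : f = g by [].
apply/funext => h; rewrite /f /g /=; congr (_ *: (u (_, _) - _)).
  by rewrite /= scaler0 add0r.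
by rewrite /= [_ *: _]mulr1.
Qed.

Definition laplacian {R : realType} {n : nat}
    (u : 'rV[R]_n * R -> R) : 'rV[R]_n * R -> R :=
  fun p => \sum_(i < n) partialx i (partialx i u) p.

(* Meant for open D, on which these conditions only depend on the values of u
   on D. *)
Definition C21 {R : realType} {n : nat} (D : set ('rV[R]_n * R))
    (u : 'rV[R]_n * R -> R) : Prop :=
  forall p, D p ->
  [/\ {for p, continuous u},
      derivable u p dirt /\ {for p, continuous (partialt u)},
      forall i, derivable u p (dirx i) /\ {for p, continuous (partialx i u)} &
      forall i j, derivable (partialx i u) p (dirx j) /\
                  {for p, continuous (partialx j (partialx i u))}].

Definition cylinder {R : realType} {n : nat} (Omega : set 'rV[R]_n) :
    set ('rV[R]_n * R) :=
  Omega `*` `]0, 1[.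

(* [sup] is 0 on unbounded or empty sets; [spatial_maxP] shows that the
   supremum below is attained in the cases of interest. *)
Definition spatial_max {R : realType} {n : nat} (K : set 'rV[R]_n)
    (u : 'rV[R]_n * R -> R) (t : R) : R :=
  sup [set u (x, t) | x in K].

Lemma spatial_maxP (R : realType) (n : nat) (Omega K : set 'rV[R]_n)
    (u : 'rV[R]_n * R -> R) (t : R) :
  C21 (cylinder Omega) u -> compact K -> K `<=` Omega -> K !=set0 ->
  0 < t < 1 ->
  exists2 x, K x & u (x, t) = spatial_max K u t /\
                   forall y, K y -> u (y, t) <= u (x, t).
Proof.
move=> uC cK KO K0 t01.
have ct : {within K, continuous (fun x => u (x, t))}.
  apply: continuous_in_subspaceT => x /set_mem Kx.
  have xtD : cylinder Omega (x, t).
    by split; [exact: KO | rewrite /= in_itv].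
  have [uc _ _ _] := uC _ xtD.
  apply: (@continuous_comp _ _ _ (fun x => (x, t)) u) => //.
  exact: (cvg_pair (G := nbhs x) (H := nbhs t) cvg_id (cvg_cst t)).
have [x /set_mem Kx xmax] := compact_EVT_max K0 cK ct.
have xmax' y : K y -> u (y, t) <= u (x, t) by move=> Ky; apply/xmax/mem_set.
exists x => //; split => //; apply/eqP; rewrite eq_le; apply/andP; split.
  apply: ub_le_sup; last by exists x.
  by exists (u (x, t)) => _ [y Ky <-]; exact: xmax'.
apply: ge_sup; first by exists (u (x, t)), x.
by move=> _ [y Ky <-]; exact: xmax'.
Qed.

(* Main.v *)
Require Import Defs.
From mathcomp Require Import all_boot all_order all_algebra.
From mathcomp Require Import all_classical all_reals all_analysis.
From mathcomp Require Import zify ring lra.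

(* Let f = u_t - Delta u. Testing with a cutoff that vanishes to second order
   bounds the local mass of u uniformly in time, and makes the total local mass
   of f finite up to t = 0; hence the mass of f is as small as we like on short
   time intervals. Maximize d ^ n u, where d is the parabolic distance to the
   boundary: near a maximum point u is at most 2 ^ n times its value v there, so
   f <= C v ^ (1 + 2/n) on a cylinder of radius K v ^ (- 1/n), which fits inside
   if d ^ n v is large. In the heat-kernel representation of u at that point
   everything is then scale invariant: the initial contribution is small because
   the mass of u is bounded and K is large, the recent contribution of f because
   of the pointwise bound, and the remaining one because the mass of f is small.
   So v < v, and d ^ n u is bounded.

   To avoid integrals over R ^ n, all this is done for u restricted to the grids
   of spacing h = L / 2 ^ N in space and h ^ 2 / 4 in time, which are nested in
   N. The heat equation is replaced by one step of the lazy random walk, the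
   product over the coordinates of the averages with weights 1/4, 1/2, 1/4; its
   kernel is an explicit product of binomial laws. The error per step is a small
   multiple of the time step. *)

Set Implicit Arguments.
Unset Strict Implicit.
Unset Printing Implicit Defensive.

Import Order.TTheory GRing.Theory Num.Theory.
Import numFieldNormedType.Exports.

Local Open Scope classical_set_scope.
Local Open Scope ring_scope.

(** * Averaging operators on a periodic grid *)

Section CyclicLattice.
Variables (R : realFieldType) (n m : nat).
Local Notation grid := {ffun 'I_n -> 'I_m.+1}.
Implicit Types (k : grid) (w p : grid -> R) (a b : 'I_m.+1).

(** The grid is wrapped around, so that shifts are bijections and summation by parts has no boundary
    terms. In the sums of interest one factor vanishes off the inner points, so wrapped values do no
    harm. *)
Definition upd (i : 'I_n) (s : 'I_m.+1 -> 'I_m.+1) k : grid :=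
  [ffun l => if l == i then s (k l) else k l].

Lemma updK i s s' : cancel s s' -> cancel (upd i s) (upd i s').
Proof.
by move=> ss' k; apply/ffunP => l; rewrite !ffunE; case: eqP => // _; rewrite ss'.
Qed.

Definition avg1 (g : 'I_m.+1 -> R) a : R := (g (ordS a) + 2 * g a + g (ord_pred a)) / 4.

Definition avg i w k : R :=
  (w (upd i (@ordS _) k) + 2 * w k + w (upd i (@ord_pred _) k)) / 4.

Definition avgs (s : seq 'I_n) w : grid -> R := foldr avg w s.

(** The transpose of [avgs s]: each [avg i] is self-adjoint, and transposing a product reverses its
    order. *)
Definition avgsr (s : seq 'I_n) w : grid -> R := foldl (fun v i => avg i v) w s.

Lemma avg_adj i p w : \sum_k p k * avg i w k = \sum_k avg i p k * w k.
Proof.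
have updSK := updK i (@ordSK m.+1); have updPK := updK i (@ord_predK m.+1).
have bS : bijective (upd i (@ordS _)) by exists (upd i (@ord_pred _)).
have bP : bijective (upd i (@ord_pred _)) by exists (upd i (@ordS _)).
have E1 : \sum_k p k * w (upd i (@ordS _) k) =
          \sum_k p (upd i (@ord_pred _) k) * w k.
  rewrite [RHS](reindex (upd i (@ordS _))) /=; last exact: onW_bij.
  by apply: eq_bigr => k _; rewrite updSK.
have E2 : \sum_k p k * w (upd i (@ord_pred _) k) =
          \sum_k p (upd i (@ordS _) k) * w k.
  rewrite [RHS](reindex (upd i (@ord_pred _))) /=; last exact: onW_bij.
  by apply: eq_bigr => k _; rewrite updPK.
have L p' w' : \sum_k p' k * avg i w' k =
  4^-1 * (\sum_k p' k * w' (upd i (@ordS _) k) + 2 * (\sum_k p' k * w' k) +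
  \sum_k p' k * w' (upd i (@ord_pred _) k)).
  rewrite mulr_sumr -!big_split mulr_sumr; apply: eq_bigr => k _ /=.
  by rewrite /avg; ring.
have C (f g : grid -> R) : \sum_k f k * g k = \sum_k g k * f k.
  by apply: eq_bigr => k _; rewrite mulrC.
rewrite (C (avg i p) w) !L E1 E2.
rewrite (C p w) (C (fun k => p (upd i (@ordS _) k)) w).
rewrite (C (fun k => p (upd i (@ord_pred _) k)) w).
by ring.
Qed.

Lemma avgs_adj s p w : \sum_k p k * avgs s w k = \sum_k avgsr s p k * w k.
Proof. by elim: s p => //= i s IH p; rewrite avg_adj IH. Qed.

Definition prodf (g : 'I_n -> 'I_m.+1 -> R) k : R := \prod_l g l (k l).

Lemma avg_prodf i (g : 'I_n -> 'I_m.+1 -> R) :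
  avg i (prodf g) =1 prodf (fun l => if l == i then avg1 (g l) else g l).
Proof.
move=> k; have E (g' : 'I_n -> 'I_m.+1 -> R) s :
    (forall l, l != i -> g' l = g l) ->
    prodf g' (upd i s k) = g' i (s (k i)) * \prod_(l | l != i) g l (k l).
  move=> gg'; rewrite /prodf (bigD1 i)//= ffunE eqxx; congr (_ * _).
  by apply: eq_bigr => l li; rewrite ffunE (negbTE li) gg'.
have E0 : upd i id k = k by apply/ffunP => l; rewrite ffunE if_same.
rewrite /avg -[in 2 * _]E0 !E // -[in RHS]E0 E ?eqxx; last first.
  by move=> l /negbTE ->.
by rewrite /avg1; ring.
Qed.

Lemma eq_avgsr s p p' : p =1 p' -> avgsr s p =1 avgsr s p'.
Proof.
elim: s p p' => //= i s IH p p' pp'; apply: IH => k.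
by rewrite /avg !pp'.
Qed.

Lemma avgsr_prodf s (g : 'I_n -> 'I_m.+1 -> R) : uniq s ->
  avgsr s (prodf g) =1 prodf (fun l => if l \in s then avg1 (g l) else g l).
Proof.
elim: s g => [|i s IH] g /=; first by [].
move=> /andP[i_s us] k; rewrite (eq_avgsr s (avg_prodf i g)) (IH _ us).
apply: eq_bigr => l _; rewrite inE; case: (eqVneq l i) => [->|//].
by rewrite (negbTE i_s).
Qed.

Definition near1 k k' := forall l,
  [\/ k' l = k l, k' l = ordS (k l) | k' l = ord_pred (k l)].

(** With [s] duplicate-free, each coordinate moves at most once and by one step, so only values at
    [near1] points enter. *)
Lemma avgs_le_near s w w' k : uniq s ->
  (forall k', near1 k k' -> w k' <= w' k') -> avgs s w k <= avgs s w' k.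
Proof.
move=> us H.
(* Generalized to a point [k0] reached after some averages: the coordinates still listed in [s] are
   unmoved. *)
suff {H} : forall k0, (forall l, k0 l = k l \/ near1 k k0 /\ l \notin s) ->
    near1 k k0 -> (forall k', near1 k k' -> w k' <= w' k') ->
    avgs s w k0 <= avgs s w' k0.
  by apply => // l; [left | constructor 1].
elim: s us => [|i s IH] /= us k0 H0 n0 H; first exact: H.
move: us => /andP[i_s us].
have ki : k0 i = k i by case: (H0 i) => // -[_]; rewrite mem_head.
have N t : (forall a, [\/ t a = a, t a = ordS a | t a = ord_pred a]) ->
  near1 k (upd i t k0).
  by move=> Ht l; rewrite ffunE; case: eqP => [->|_]; [rewrite ki; exact: Ht|exact: n0].
have IH' t : (forall a, [\/ t a = a, t a = ordS a | t a = ord_pred a]) ->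
    avgs s w (upd i t k0) <= avgs s w' (upd i t k0).
  move=> Ht; apply: IH => //; last exact: N.
  move=> l; rewrite ffunE; case: eqP => [->|/eqP li].
    by right; split => //; exact: N.
  case: (H0 l) => [|[_]]; first by left.
  by rewrite in_cons (negbTE li) /= => ls; right; split => //; exact: N.
rewrite /avg ler_pM2r ?invr_gt0//.
have I0 : upd i id k0 = k0 by apply/ffunP => l; rewrite ffunE if_same.
apply: lerD; first apply: lerD.
- by apply: IH' => a; constructor 2.
- by rewrite ler_pM2l//; have := IH' id; rewrite I0; apply => a; constructor 1.
- by apply: IH' => a; constructor 3.
Qed.

Lemma avgsB s w w' k :
  avgs s (fun k => w k - w' k) k = avgs s w k - avgs s w' k.
Proof. by elim: s k => //= i s IH k; rewrite /avg !IH; ring. Qed.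

Lemma avgs_ge0 s w k : (forall k, 0 <= w k) -> 0 <= avgs s w k.
Proof.
move=> w0; elim: s k => //= i s IH k.
by rewrite /avg mulr_ge0 ?invr_ge0// !addr_ge0 ?mulr_ge0.
Qed.

Definition inner a := (0 < a < m)%N.

(* An additive drift of [avg i] at the points that are inner in direction [i],
   constant up to [eta] from a point to its neighbours, accumulates over the
   composition. *)
Lemma avgs_drift s w (D : 'I_n -> grid -> R) (eps eta : R) k :
  uniq s -> 0 <= eps -> 0 <= eta ->
  (forall i k, inner (k i) -> `|avg i w k - w k - D i k| <= eps) ->
  (forall i l k, inner (k i) -> `|avg i (D l) k - D l k| <= eta) ->
  (forall l, l \in s -> inner (k l)) ->
  `|avgs s w k - w k - \sum_(i <- s) D i k| <=
    (size s)%:R * (eps + (size s)%:R * eta).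
Proof.
move=> us eps0 eta0 Hw HD.
elim: s us k => [|i s IH] /= us k ks; first by rewrite big_nil subr0 subrr normr0 mul0r.
move: us => /andP[i_s us].
have ki : inner (k i) by apply: ks; rewrite mem_head.
have IHu t : `|avgs s w (upd i t k) - w (upd i t k) - \sum_(l <- s) D l (upd i t k)| <=
    (size s)%:R * (eps + (size s)%:R * eta).
  apply: IH => // l ls; rewrite ffunE; case: eqP => [li|_]; first by rewrite -li ls in i_s.
  by apply: ks; rewrite in_cons ls orbT.
have IH0 : `|avgs s w k - w k - \sum_(l <- s) D l k| <= (size s)%:R * (eps + (size s)%:R * eta).
  by apply: IH => // l ls; apply: ks; rewrite in_cons ls orbT.
have HS : `|\sum_(l <- s) (avg i (D l) k - D l k)| <= (size s)%:R * eta.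
  apply: le_trans (ler_norm_sum _ _ _) _.
  rewrite -sum1_size natr_sum mulr_suml.
  by apply: ler_sum => l _; rewrite mul1r; exact: HD.
have := IHu (@ordS _); have := IHu (@ord_pred _); have := Hw _ _ ki.
rewrite big_cons.
have ES : \sum_(l <- s) (avg i (D l) k - D l k) =
   (\sum_(l <- s) D l (upd i (@ordS _) k) + 2 * (\sum_(l <- s) D l k) +
   \sum_(l <- s) D l (upd i (@ord_pred _) k)) / 4 - \sum_(l <- s) D l k.
  rewrite sumrB; congr (_ - _); rewrite mulr_sumr -!big_split mulr_suml.
  by apply: eq_bigr.
rewrite ES {ES} in HS; move: IH0 HS; rewrite /avg.
set e := _ * (_ + _).
set a1 := avgs s w k; set a2 := avgs s w _; set a3 := avgs s w _.
set d1 := \sum_(_ <- s) _; set d2 := \sum_(_ <- s) _; set d3 := \sum_(_ <- s) _.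
set w2 := w (upd _ _ _); set w3 := w (upd _ _ _).
rewrite !ler_norml => H1 H2 H3 H4 H5.
have E : e + eps + (size s)%:R * eta <= (size s).+1%:R * (eps + (size s).+1%:R * eta).
  rewrite -subr_ge0 /e -[_.+1%:R]natr1.
  rewrite [leRHS](_ : _ = ((size s)%:R + 1) * eta); last by ring.
  by rewrite mulr_ge0 ?addr_ge0.
move: E H1 H2 H3 H4 H5; move: (_.+1%:R * _) ((size s)%:R * eta) => E0 E1 E.
move=> /andP[H1 H1'] /andP[H2 H2'] /andP[H3 H3'] /andP[H4 H4'] /andP[H5 H5'].
by clear -E H1 H1' H2 H2' H3 H3' H4 H4' H5 H5'; apply/andP; split; lra.
Qed.

End CyclicLattice.

(** * Binomial walk and cutoff *)

(** Extended by zero to negative integers, so that Pascal's rule holds for every [z]. *)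
Definition binz (q : nat) (z : int) : nat := if z is Posz u then 'C(q, u) else 0.

Lemma binzS q z : binz q.+1 z = (binz q z + binz q (z - 1))%N.
Proof.
case: z => [[|u]|u]; rewrite ?bin0 //.
  by rewrite /binz !bin0.
by rewrite (_ : u.+1%:Z - 1 = u) ?binS //; lia.
Qed.

(** By Pascal's rule a window in one row is the sum of two windows of the row above, so the bound
    doubles; row 0 has a single nonzero entry. *)
Lemma sum_binz q (z : int) M : (\sum_(a < M) binz q (z + a%:Z) <= 2 ^ q)%N.
Proof.
elim: q z => [|q IH] z; last first.
  under eq_bigr do rewrite binzS -addrAC.
  by rewrite big_split /= expnS mul2n -addnn leq_add.
have E a : binz 0 (z + a%:Z) = (z + a%:Z == 0) by case: (z + a%:Z) => [[|?]|?].
under eq_bigr do rewrite E.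
case: (pickP (fun a : 'I_M => z + a%:Z == 0)) => [a a0|no]; last first.
  by rewrite big1 // => a _; rewrite no.
rewrite (bigD1 a)//= a0 big1 // => b ba.
apply/eqP; rewrite eqb0; apply: contra ba => /eqP b0; apply/eqP/val_inj => /=.
by move/eqP: a0; lia.
Qed.

(** Ratios of consecutive entries show growth up to the middle; symmetry settles the other half. *)
Lemma bin2_central_max r u : ('C(r.*2, u) <= 'C(r.*2, r))%N.
Proof.
have L v : (v <= r)%N -> ('C(r.*2, v) <= 'C(r.*2, r))%N.
  move=> vr; rewrite -(subKn vr); elim: (r - v)%N (leq_subr v r) => [|d IH] dr.
    by rewrite subn0.
  apply: leq_trans (IH (ltnW dr)).
  have := mul_bin_left r.*2 (r - d.+1); rewrite -subSn // subSS => E.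
  have : (0 < r - d)%N by lia.
  move=> rd; rewrite -(leq_pmul2l rd) E leq_pmul2r; first lia.
  by rewrite bin_gt0; lia.
case: (leqP u r) => [|ru]; first exact: L.
case: (leqP u r.*2) => [u2|u2]; last by rewrite bin_small.
by rewrite -bin_sub //; apply: L; lia.
Qed.

(** Squared to stay in the integers. The recurrence [E] reduces the induction to (2r + 1) (2r + 3)
    <= (2r + 2) ^ 2. *)
Lemma central_bin_le r : ('C(r.*2, r) ^ 2 * r.*2.+1 <= 16 ^ r)%N.
Proof.
elim: r => [|r IH]; first by rewrite bin0.
have E : (r.+1 * 'C(r.+1.*2, r.+1) = 2 * r.*2.+1 * 'C(r.*2, r))%N.
  have := mul_bin_diag r.*2.+2 r; have := mul_bin_down r.*2.+1 r.
  rewrite -!doubleS [r.*2.+1.-1]/= [r.+1.*2.-1]/= => E1 E2.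
  rewrite (_ : (r.*2.+1 - r = r.+1)%N) in E1; last lia.
  have E3 : (r.*2.+1 * 'C(r.*2, r) = r.+1 * 'C(r.*2.+1, r))%N by lia.
  by rewrite -E2 -mulnA E3; nia.
have r0 : (0 < r.+1 ^ 2)%N by rewrite expn_gt0.
rewrite -(leq_pmul2l r0) mulnA -expnMn E !expnMn (expnS 16).
set c := ('C(r.*2, r) ^ 2)%N in IH *.
have -> : (2 ^ 2 * r.*2.+1 ^ 2 * c * r.+1.*2.+1 = c * r.*2.+1 * (4 * (r.*2.+1 * r.+1.*2.+1)))%N.
  by ring.
have -> : (r.+1 ^ 2 * (16 * 16 ^ r) = 16 ^ r * (4 * (4 * r.+1 ^ 2)))%N by ring.
apply: leq_mul => //; rewrite leq_pmul2l //; nia.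
Qed.

Lemma inner_ordS m (a : 'I_m.+1) : inner a -> ordS a = a.+1 :> nat.
Proof. by move=> /andP[_ am] /=; rewrite modn_small. Qed.

Lemma inner_ord_pred m (a : 'I_m.+1) : inner a -> ord_pred a = a.-1 :> nat.
Proof.
move=> /andP[a0 am] /=; rewrite (_ : (a + m.+1).-1 = m.+1 + a.-1)%N; last by lia.
by rewrite modnDl modn_small //; lia.
Qed.

Section Kernel.
Variables (R : realFieldType) (m : nat).
Implicit Types (a c : 'I_m.+1) (r : nat).

(* The law after [r] steps of the lazy walk with step weights 1/4, 1/2, 1/4
   started at [c]. *)
Definition walk c r a : R := (binz r.*2 (r%:Z - c%:Z + a%:Z))%:R / 4 ^+ r.

Lemma walk_ge0 c r a : 0 <= walk c r a.
Proof. by rewrite /walk divr_ge0 // exprn_ge0. Qed.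

Lemma walk0 c a : walk c 0 a = (a == c)%:R.
Proof.
rewrite /walk expr0 divr1; congr (_%:R).
have -> : (a == c) = ((0%N%:Z - c%:Z + a%:Z) == 0).
  by apply/eqP/eqP => [->|H]; [lia|apply: val_inj => /=; lia].
by case: (_ + _) => [[|?]|?].
Qed.

(** One lazy step is two fair coin tosses: Pascal's rule used twice gives the weights 1, 2, 1. At
    the ends the neighbours wrap around, hence the restriction to inner points. *)
Lemma walkS c r a : inner a -> avg1 (walk c r) a = walk c r.+1 a.
Proof.
move=> ia; rewrite /avg1 /walk inner_ordS // inner_ord_pred //.
have /andP[a0 am] := ia.
rewrite doubleS !binzS.
set z := (r%:Z - c%:Z + a%:Z).
have -> : r%:Z - c%:Z + (a.+1)%N%:Z = z + 1 by rewrite /z; lia.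
have -> : r%:Z - c%:Z + (a.-1)%N%:Z = z - 1 by rewrite /z; lia.
have -> : r.+1%:Z - c%:Z + a%:Z = z + 1 by rewrite /z; lia.
rewrite addrK !natrD exprS.
have : (4 : R) ^+ r != 0 by rewrite expf_neq0 // pnatr_eq0.
by move=> ?; field.
Qed.

(** Decay of the kernel like the inverse square root of time, squared to avoid roots. *)
Lemma walk_sqr_le c r a : walk c r a ^+ 2 * r.*2.+1%:R <= 1.
Proof.
rewrite /walk expr_div_n -exprM mulrAC ler_pdivrMr ?exprn_gt0// mul1r.
rewrite mulnC exprM -[4]/(4%:R) -!natrX -natrM ler_nat.
apply: leq_trans (central_bin_le r); rewrite leq_mul2r leq_sqr; apply/orP; right.
by case: (_ + _) => [u|//]; exact: bin2_central_max.
Qed.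

Lemma sum_walk_le c r : \sum_a walk c r a <= 1.
Proof.
rewrite /walk -mulr_suml ler_pdivrMr ?exprn_gt0// mul1r -natr_sum -natrX ler_nat.
by apply: leq_trans (sum_binz _ _ _) _; rewrite -mul2n expnM.
Qed.

(* The square of [4 a (m - a) / m ^ 2] vanishes to second order at both ends of
   the grid, so its second differences are nonnegative there. *)
Definition hat a : R := (4 * a%:R * (m%:R - a%:R) / m%:R ^+ 2) ^+ 2.

Lemma hat_ge0 a : 0 <= hat a.
Proof. exact: sqr_ge0. Qed.

Lemma hat_le1 a : hat a <= 1.
Proof.
have am : a%:R <= m%:R :> R by rewrite ler_nat -ltnS.
have a0 : 0 <= a%:R :> R by [].
have M0 : 0 <= m%:R :> R by [].
rewrite /hat; move: (a%:R : R) (m%:R : R) a0 am M0 => x M x0 xM.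
rewrite le_eqVlt => /predU1P[<-|M0].
  by rewrite expr0n invr0 mulr0 expr0n.
rewrite expr_le1 //; last by rewrite divr_ge0 ?sqr_ge0 ?mulr_ge0 ?subr_ge0.
by rewrite ler_pdivrMr ?exprn_gt0 //; have := sqr_ge0 (M - 2 * x); nra.
Qed.

Lemma hat_outer a : ~~ inner a -> hat a = 0.
Proof.
rewrite /inner negb_and -!leqNgt leqn0 /hat => /orP[/eqP->|ma].
  by rewrite mulr0 !mul0r expr0n.
have -> : nat_of_ord a = m by apply/eqP; rewrite eqn_leq ma -ltnS ltn_ord.
by rewrite subrr mulr0 mul0r expr0n.
Qed.

Lemma hat_mid a : m%:R <= 4 * a%:R :> R -> 4 * a%:R <= 3 * m%:R :> R ->
  (0 < m)%N -> 2^-1 <= hat a.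
Proof.
move=> a1 a2 m0; have m0' : 0 < m%:R :> R by rewrite ltr0n.
(* With x = a / m in the middle half, 4 x (1 - x) >= 3/4, whose square 9/16 exceeds 1/2. *)
have H : 3 / 4 <= 4 * a%:R * (m%:R - a%:R) / m%:R ^+ 2 :> R.
  by rewrite ler_pdivlMr ?exprn_gt0 //; nra.
by rewrite /hat; nra.
Qed.

(** Discrete form of Delta phi >= - C phi for the cutoff: the second difference of [hat] can be
    negative only away from the ends, where [hat] is not small. *)
Lemma avg1_hat a : (1 - 5 / m%:R ^+ 2) * hat a <= avg1 hat a.
Proof.
have [ia|ia] := boolP (inner a); last first.
  rewrite hat_outer // mulr0 /avg1.
  by have := hat_ge0 (ordS a); have := hat_ge0 (ord_pred a); have := hat_ge0 a; lra.
have /andP[a0 am] := ia; rewrite /avg1 /hat inner_ordS // inner_ord_pred //.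
rewrite -[(a.+1)%:R]natr1.
have -> : (a.-1)%:R = a%:R - 1 :> R by rewrite -[in RHS](prednK a0) -natr1 addrK.
have m0 : 0 < m%:R :> R by rewrite ltr0n; lia.
rewrite -subr_ge0.
move: a0 am => _ _; move: (a%:R : R) (m%:R : R) m0 => x M M0.
have M2 : M != 0 by rewrite gt_eqF.
rewrite (_ : _ - _ = (4 / M ^+ 4) * (2 * M ^+ 2 - 12 * (x * (M - x)) + 2 + 20 * (x * (M - x)) ^+ 2 / M ^+ 2)); last by field.
rewrite mulr_ge0 //; first by rewrite divr_ge0 // exprn_ge0 // ltW.
set q := x * (M - x).
(* Completing the square in [q]: the loss constant 5 yields 20 q ^ 2, of which the square uses
   18. *)
rewrite (_ : _ + _ = 2 + (2 * (M ^+ 2 - 3 * q) ^+ 2 + 2 * q ^+ 2) / M ^+ 2); last by field.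
by rewrite addr_ge0 // divr_ge0 ?sqr_ge0 // addr_ge0 // mulr_ge0 // sqr_ge0.
Qed.

End Kernel.

(** * Discrete representation formula *)

Section Duhamel.
Variables (R : realFieldType) (n m : nat).
Local Notation grid := {ffun 'I_n -> 'I_m.+1}.
Implicit Types (k kb : grid) (r j J : nat).

Definition mean (w : grid -> R) : grid -> R := avgs (enum 'I_n) w.

Lemma mean_drift (w : grid -> R) (D : 'I_n -> grid -> R) (eps eta : R) k :
  0 <= eps -> 0 <= eta ->
  (forall i k, inner (k i) -> `|avg i w k - w k - D i k| <= eps) ->
  (forall i l k, inner (k i) -> `|avg i (D l) k - D l k| <= eta) ->
  (forall l, inner (k l)) ->
  `|mean w k - w k - \sum_i D i k| <= n%:R * (eps + n%:R * eta).
Proof.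
move=> e0 e1 H1 H2 ik.
have := @avgs_drift _ _ _ (enum 'I_n) w D eps eta k (enum_uniq _) e0 e1 H1 H2 (fun l _ => ik l).
by rewrite size_enum_ord big_enum.
Qed.

Lemma mean_adj_prodf (g : 'I_n -> 'I_m.+1 -> R) (w : grid -> R) :
  \sum_k prodf g k * mean w k = \sum_k prodf (fun l => avg1 (g l)) k * w k.
Proof.
rewrite avgs_adj; apply: eq_bigr => k _; congr (_ * _).
rewrite avgsr_prodf ?enum_uniq //; apply: eq_bigr => l _.
by rewrite mem_enum.
Qed.

Definition walkn kb r : grid -> R := prodf (fun l => walk R (kb l) r).

Lemma walkn_ge0 kb r k : 0 <= walkn kb r k.
Proof. by apply: prodr_ge0 => l _; exact: walk_ge0. Qed.

Lemma walkn0 kb k : walkn kb 0 k = (k == kb)%:R.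
Proof.
rewrite /walkn /prodf; under eq_bigr do rewrite walk0.
case: eqP => [->|/eqP]; first by rewrite big1 // => l _; rewrite eqxx.
move=> kkb; have /existsP[l lk] : [exists l, k l != kb l].
  apply: contraNT kkb => /existsPn H; apply/eqP/ffunP => l.
  by apply/eqP; rewrite -[_ == _]negbK H.
by rewrite (bigD1 l)//= (negbTE lk) mul0r.
Qed.

Lemma sum_walkn_le kb r : \sum_k walkn kb r k <= 1.
Proof.
rewrite /walkn /prodf -(bigA_distr_bigA (fun l a => walk R (kb l) r a)) /=.
apply: prodr_ile1 => l _; rewrite sum_walk_le sumr_ge0 // => a _.
exact: walk_ge0.
Qed.

(** [h ^+ n] is the volume of a cell and [y] a length of at most the order of the square root of the
    elapsed time: this is the bound t ^ (-n/2) on the heat kernel. *)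
Lemma walkn_le kb r k (h y : R) : 0 < y -> 0 < h ->
  y ^+ 2 <= r.*2.+1%:R * h ^+ 2 -> walkn kb r k <= (h / y) ^+ n.
Proof.
move=> y0 h0 yh; rewrite /walkn /prodf.
rewrite -[X in (h / y) ^+ X]card_ord -prodr_const; apply: ler_prod => l _.
rewrite walk_ge0 /= ler_pdivlMr //.
set w := walk _ _ _ _; have w0 : 0 <= w by exact: walk_ge0.
have [y0' h0'] := (ltW y0, ltW h0).
have wy0 : 0 <= w * y by rewrite mulr_ge0.
suff H : (w * y) ^+ 2 <= h ^+ 2 by move: H; rewrite ler_sqr.
rewrite exprMn.
apply: le_trans (ler_wpM2l (sqr_ge0 w) yh) _.
rewrite mulrA; apply: le_trans (ler_wpM2r (sqr_ge0 h) (walk_sqr_le R (kb l) r (k l))) _.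
by rewrite mul1r.
Qed.

Definition inside k := forall l, inner (k l).

(** Moves one averaging step from [w] to the kernel. [walkS] holds at inner points, so [w] has to
    vanish elsewhere. *)
Lemma sum_walkn_mean kb r (w : grid -> R) : (forall k, w k != 0 -> inside k) ->
  \sum_k walkn kb r k * mean w k = \sum_k walkn kb r.+1 k * w k.
Proof.
move=> wi; rewrite mean_adj_prodf; apply: eq_bigr => k _.
have [->|wk] := eqVneq (w k) 0; first by rewrite !mulr0.
congr (_ * _); apply: eq_bigr => l _; apply: walkS; exact: wi.
Qed.

(** The recursion is unrolled backwards from time [J], the kernel absorbing one step each time. *)
Lemma duhamel kb (W g : nat -> grid -> R) J :
  (forall j k, W j k != 0 -> inside k) ->
  (forall j k, (j < J)%N -> W j.+1 k <= mean (W j) k + g j k) ->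
  W J kb <= \sum_k walkn kb J k * W 0 k +
            \sum_(r < J) \sum_k walkn kb r k * g (J - r.+1)%N k.
Proof.
move=> Win WS; suff : forall i, (i <= J)%N ->
    W J kb <= \sum_k walkn kb i k * W (J - i)%N k +
            \sum_(r < i) \sum_k walkn kb r k * g (J - r.+1)%N k.
  by move=> /(_ J (leqnn _)); rewrite subnn.
elim=> [|i IH] iJ.
  rewrite subn0 big_ord0 addr0 (bigD1 kb)//= walkn0 eqxx mul1r big1 ?addr0 // => k.
  by move=> /negbTE kkb; rewrite walkn0 kkb mul0r.
apply: le_trans (IH (ltnW iJ)) _.
rewrite big_ord_recr /= [X in _ <= _ + X]addrC addrA lerD2r.
rewrite -sum_walkn_mean; last by move=> k; exact: Win.
rewrite -big_split; apply: ler_sum => k _ /=.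
rewrite -mulrDr ler_wpM2l ?walkn_ge0 //.
have E : (J - i = (J - i.+1).+1)%N by lia.
by rewrite E; apply: WS; lia.
Qed.

(** Sources are split by age at [r0]: younger ones are bounded by their supremum [F] against a
    kernel of mass at most 1, older ones by their total mass against the supremum of the kernel. *)
Lemma duhamel_le kb (W : nat -> grid -> R) (f : nat -> grid -> R) (D : pred grid)
    J r0 (h d y1 y2 e F : R) :
  0 < y1 -> 0 < y2 -> 0 < h -> 0 <= d -> 0 <= e -> 0 <= F ->
  y1 ^+ 2 <= J.*2.+1%:R * h ^+ 2 -> y2 ^+ 2 <= r0.*2.+1%:R * h ^+ 2 ->
  (forall j k, W j k != 0 -> inside k) -> (forall k, 0 <= W 0%N k) ->
  (forall j k, (j < J)%N -> D k -> 0 <= f j k <= F) ->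
  (forall j k, (j < J)%N ->
     W j.+1 k <= mean (W j) k + d * ((if D k then f j k else 0) + e)) ->
  W J kb <= (h / y1) ^+ n * (\sum_k W 0 k) + r0%:R * d * F +
    (h / y2) ^+ n * (\sum_(j < J) d * \sum_(k | D k) f j k) + J%:R * d * e.
Proof.
move=> y10 y20 h0 d0 e0 F0 hy1 hy2 Win W0 f0 WS.
apply: le_trans (duhamel kb (g := fun j k => d * ((if D k then f j k else 0) + e)) Win WS) _.
rewrite -!addrA; apply: lerD.
  by rewrite mulr_sumr; apply: ler_sum => k _; rewrite ler_wpM2r ?walkn_le.
have f0' j k : (j < J)%N -> 0 <= (if D k then f j k else 0) <= F.
  by move=> jJ; case: ifP => Dk; [exact: f0|rewrite lexx].
have step (r : 'I_J) : \sum_k walkn kb r k * (d * ((if D k then f (J - r.+1)%N k else 0) + e))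
    <= (if (r < r0)%N then d * F else 0) +
       (h / y2) ^+ n * (d * \sum_(k | D k) f (J - r.+1)%N k) + d * e.
  have rJ : (J - r.+1 < J)%N by have := ltn_ord r; lia.
  have hyn : 0 <= (h / y2) ^+ n by rewrite exprn_ge0 // divr_ge0 // ltW.
  have s0 : 0 <= \sum_(k | D k) f (J - r.+1)%N k.
    by apply: sumr_ge0 => k Dk; have /andP[] := f0 _ _ rJ Dk.
  have E : \sum_k walkn kb r k * (d * e) <= d * e.
    by rewrite -mulr_suml ler_piMl ?mulr_ge0 ?sum_walkn_le.
  rewrite (eq_bigr (fun k => walkn kb r k * (d * (if D k then f (J - r.+1)%N k else 0)) +
    walkn kb r k * (d * e))); last by move=> k _; rewrite -mulrDr -mulrDr.
  rewrite big_split lerD //=; case: ltnP => rr.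
    apply: ler_wpDr; first by rewrite !mulr_ge0.
    apply: (@le_trans _ _ (\sum_k walkn kb r k * (d * F))).
      apply: ler_sum => k _; rewrite ler_wpM2l ?walkn_ge0 // ler_wpM2l //.
      by have /andP[] := f0' _ k rJ.
    by rewrite -mulr_suml ler_piMl ?mulr_ge0 ?sum_walkn_le.
  rewrite add0r (big_mkcond D) !mulr_sumr; apply: ler_sum => k _.
  rewrite ler_wpM2r ?walkn_le //.
    by rewrite mulr_ge0 //; have /andP[] := f0' _ k rJ.
  apply: le_trans hy2 _; rewrite ler_wpM2r ?sqr_ge0 // ler_nat ltnS.
  by rewrite leq_double.
apply: le_trans; first by apply: ler_sum => r _; exact: step.
rewrite !big_split /= -addrA; apply: lerD.
  have -> : \sum_(r < J) (if (r < r0)%N then d * F else 0) = (minn J r0)%:R * (d * F).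
    elim: (J) => [|J' IH]; first by rewrite big_ord0 min0n mul0r.
    rewrite big_ord_recr IH /=; have [Jr|Jr] := ltnP J' r0.
      by rewrite (minn_idPl Jr) -natr1 mulrDl mul1r.
    by rewrite addr0 (minn_idPr (leqW Jr)).
  by rewrite -mulrA ler_wpM2r ?mulr_ge0 // ler_nat geq_minr.
apply: lerD; last by rewrite sumr_const card_ord -[_ *+ J]mulr_natl mulrA.
(* Reversing the index turns the age [r] of a source into its time [J - r.+1]. *)
by rewrite -mulr_sumr [X in _ <= _ * X](reindex_inj rev_ord_inj) /=.
Qed.


(* [W] below is the positive part of [U] minus a discrete caloric paraboloid
   which dominates [U] on the lateral boundary of the cube. *)
Lemma local_max_principle (U f : nat -> grid -> R) kb J r0
    (h d rho M y1 y2 e F : R) :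
  d = h ^+ 2 / 4 -> 0 < h -> h <= rho -> 0 < y1 -> 0 < y2 -> 0 <= e -> 0 <= F ->
  y1 ^+ 2 <= J.*2.+1%:R * h ^+ 2 -> y2 ^+ 2 <= r0.*2.+1%:R * h ^+ 2 ->
  let D k := [forall l, `|h * (k l)%:R - h * (kb l)%:R| < rho] in
  (forall k, D k -> inside k) ->
  (forall j k, (j <= J)%N ->
    (forall l, `|h * (k l)%:R - h * (kb l)%:R| <= 2 * rho) -> 0 <= U j k <= M) ->
  (forall j k, (j < J)%N -> D k -> 0 <= f j k <= F) ->
  (forall j k, (j < J)%N -> D k -> U j.+1 k <= mean (U j) k + d * f j k + d * e) ->
  U J kb - M * (2 * n%:R * (J%:R * d)) / rho ^+ 2 <=
    (h / y1) ^+ n * (\sum_(k | D k) U 0 k) + r0%:R * d * F +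
    (h / y2) ^+ n * (\sum_(j < J) d * \sum_(k | D k) f j k) + J%:R * d * e.
Proof.
move=> dE h0 hrho y10 y20 e0 F0 hy1 hy2 D Din U0 f0 US.
have rho0 : 0 < rho by exact: lt_le_trans hrho.
have d0 : 0 <= d by rewrite dE divr_ge0 ?sqr_ge0.
have Dkb : D kb by apply/forallP => l; rewrite subrr normr0.
have Dfar k l : D k -> `|h * (k l)%:R - h * (kb l)%:R| < rho by move/forallP.
have M0 : 0 <= M.
  have /andP[H1 H2] : 0 <= U 0%N kb <= M.
    by apply: U0 => // l; rewrite subrr normr0 mulr_ge0 // ltW.
  exact: le_trans H2.
pose q l (a : 'I_m.+1) := (h * a%:R - h * (kb l)%:R) ^+ 2.
(* The paraboloid |x - xb| ^ 2 + 2 n t is exactly caloric: [avg i] adds h ^ 2 / 2 = 2 d to the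
   square in direction [i]. The factor M / rho ^ 2 makes it at least [M] where some coordinate is
   [rho] away. *)
pose B j k := M * (\sum_l q l (k l) + 2 * n%:R * (j%:R * d)) / rho ^+ 2.
have B0 j k : 0 <= B j k.
  rewrite /B divr_ge0 ?sqr_ge0 // mulr_ge0 // addr_ge0 //.
    by apply: sumr_ge0 => l _; rewrite sqr_ge0.
  by rewrite !mulr_ge0.
have avgB i j k : inner (k i) -> avg i (B j) k = B j k + M * (2 * d) / rho ^+ 2.
  move=> ki.
  have Bu s : B j (upd i s k) =
      M * (\sum_(l | l != i) q l (k l) + q i (s (k i)) + 2 * n%:R * (j%:R * d)) / rho ^+ 2.
    rewrite /B; congr (M * (_ + _) / _).
    rewrite (bigD1 i)//= addrC ffunE eqxx; congr (_ + _).
    by apply: eq_bigr => l /negbTE li; rewrite ffunE li.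
  have E0 : upd i id k = k by apply/ffunP => l; rewrite ffunE if_same.
  rewrite /avg -{2 4}E0 !Bu /q inner_ordS // inner_ord_pred //.
  have -> : ((k i).-1)%:R = (k i)%:R - 1 :> R.
    by case/andP: ki => k0 _; rewrite -[in RHS](prednK k0) -natr1 addrK.
  by rewrite -[((k i).+1)%:R]natr1 dE; field; rewrite gt_eqF.
have BS j k : inside k -> mean (B j) k = B j.+1 k.
  move=> ik.
  have H : `|mean (B j) k - B j k - \sum_(i < n) M * (2 * d) / rho ^+ 2| <=
      n%:R * (0 + n%:R * 0).
    apply: (@mean_drift (B j) (fun _ _ => M * (2 * d) / rho ^+ 2)) => //.
      by move=> i k' ki; rewrite avgB // [B _ _ + _]addrC addrK subrr normr0.
    by move=> i l k' ki; rewrite /avg normr_le0; apply/eqP; field; rewrite gt_eqF.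
  move: H; rewrite mulr0 addr0 mulr0 normr_le0 sumr_const card_ord.
  rewrite -addrA -opprD subr_eq0 => /eqP ->.
  by rewrite /B -natr1 -[_ *+ n]mulr_natl; field; rewrite gt_eqF.
pose W j k := if D k then Num.max (U j k - B j k) 0 else 0.
have W0 j k : 0 <= W j k by rewrite /W; case: ifP => // _; rewrite le_max lexx orbT.
have WJ : U J kb - M * (2 * n%:R * (J%:R * d)) / rho ^+ 2 <= W J kb.
  rewrite /W Dkb le_max; apply/orP; left; rewrite lerD2l lerN2 /B.
  by rewrite big1 ?add0r // => l _; rewrite /q subrr expr0n.
apply: le_trans WJ _.
have Win j k : W j k != 0 -> inside k.
  by rewrite /W; case: ifP => [/Din //|_]; rewrite eqxx.
apply: le_trans (@duhamel_le kb W f D J r0 h d y1 y2 e F y10 y20 h0 d0 e0 F0 hy1 hy2 Win (W0 0%N) f0 _) _; last first.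
  rewrite !lerD2r; apply: ler_wpM2l; first by rewrite exprn_ge0 // divr_ge0 // ltW.
  rewrite [leRHS]big_mkcond; apply: ler_sum => k _; rewrite /W; case: ifP => // Dk.
  have /andP[Uk _] : 0 <= U 0%N k <= M.
    apply: U0 => // l; apply: ltW; apply: lt_le_trans (Dfar _ _ Dk) _.
    by rewrite ler_peMl ?ler1n // ltW.
  by rewrite ge_max Uk andbT lerBlDr lerDl.
move=> j k jJ; rewrite {1}/W; case: ifP => Dk; last first.
  by rewrite add0r addr_ge0 ?mulr_ge0 //; exact: avgs_ge0.
have ik := Din _ Dk; have /andP[f0k _] := f0 _ _ jJ Dk.
rewrite ge_max; apply/andP; split; last first.
  by rewrite addr_ge0 ?mulr_ge0 ?addr_ge0 //; exact: avgs_ge0.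
rewrite -(BS _ _ ik) lerBlDr; apply: le_trans (US _ _ jJ Dk) _.
rewrite -addrA -mulrDr addrAC lerD2r -lerBlDr -avgsB.
apply: avgs_le_near => [|k' kk']; first exact: enum_uniq.
(* One step from [D] stays within [2 * rho] because [h <= rho], so the bound [M] on [U] still
   applies. *)
have k'far l : `|h * (k' l)%:R - h * (kb l)%:R| <= 2 * rho.
  have H : `|h * (k' l)%:R - h * (k l)%:R| <= h.
    rewrite -mulrBr normrM (gtr0_norm h0) ler_piMr ?(ltW h0) //.
    case: (kk' l) => ->; first by rewrite subrr normr0.
      by rewrite (inner_ordS (ik l)) -natr1 [_ + 1]addrC addrK normr1.
    rewrite (inner_ord_pred (ik l)); case/andP: (ik l) => k0 _.
    by rewrite -[X in _ - X%:R](prednK k0) -natr1 opprD addrA subrr add0r normrN normr1.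
  rewrite -(subrKA (h * (k l)%:R)) mulr2n mulrDl mul1r; apply: le_trans (ler_normD _ _) _.
  by apply: lerD; [exact: le_trans hrho|exact: ltW (Dfar _ _ Dk)].
rewrite /W; case: ifPn => [_|]; first by rewrite le_max lexx.
(* Off [D] the paraboloid is at least [M], so [U - B] is nonpositive and [W], being 0 there,
   dominates it. *)
move=> /forallPn[l]; rewrite -leNgt => lrho.
have /andP[_ UM] := U0 j k' (ltnW jJ) k'far.
rewrite subr_le0; apply: le_trans UM _.
rewrite /B ler_pdivlMr ?exprn_gt0 // ler_wpM2l // -[leLHS]addr0 lerD //.
  rewrite (bigD1 l)//= -[leLHS]addr0 lerD //; last by apply: sumr_ge0 => ? _; exact: sqr_ge0.
  by rewrite /q -[leRHS]real_normK ?num_real // ler_sqr ?nnegrE // ltW.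
by rewrite !mulr_ge0.
Qed.

End Duhamel.

(** * Mass and oscillation *)

Section Mass.
Variables (R : archiRealFieldType) (n m : nat).
Local Notation grid := {ffun 'I_n -> 'I_m.+1}.
Implicit Types (k : grid) (j : nat).

Definition hatn : grid -> R := prodf (fun _ => hat R (m := m)).

Lemma hatn_ge0 k : 0 <= hatn k.
Proof. by apply: prodr_ge0 => l _; exact: hat_ge0. Qed.

Lemma hatn_le1 k : hatn k <= 1.
Proof. by apply: prodr_ile1 => l _; rewrite hat_ge0 hat_le1. Qed.

Lemma hatn_inside k : hatn k != 0 -> inside k.
Proof.
move=> kn0 l; apply: contraNT kn0 => kl.
by rewrite /hatn /prodf (bigD1 l)//= hat_outer // mul0r.
Qed.

Lemma hatn_mid k : (0 < m)%N ->
  (forall l, m%:R <= 4 * (k l)%:R :> R /\ 4 * (k l)%:R <= 3 * m%:R :> R) ->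
  2^-1 ^+ n <= hatn k.
Proof.
move=> m0 H; rewrite -[X in _ ^+ X]card_ord -prodr_const; apply: ler_prod => l _.
by rewrite invr_ge0 ler0n /=; have [? ?] := H l; exact: hat_mid.
Qed.

Lemma bernoulli (x : R) q : 0 <= x -> x <= 1 -> 1 - q%:R * x <= (1 - x) ^+ q.
Proof.
move=> x0 x1; elim: q => [|q IH]; first by rewrite mul0r subr0.
rewrite exprS; apply: le_trans (ler_wpM2l _ IH); last by rewrite subr_ge0.
by rewrite -natr1 -subr_ge0 [leRHS](_ : _ = q%:R * x ^+ 2); [rewrite mulr_ge0 ?sqr_ge0|ring].
Qed.

(** The averaging is moved to the cutoff, where [avg1_hat] costs a factor 1 - 5 / m ^ 2 in each
    direction; [bernoulli] makes the total loss linear in [n]. *)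
Lemma mass_step (U U' f : grid -> R) (h d e B : R) :
  0 <= h -> 0 <= d -> 0 <= e -> 5 <= m%:R ^+ 2 :> R ->
  (forall k, 0 <= U k) ->
  (forall k, inside k -> mean U k + d * f k - d * e <= U' k) ->
  (h * m.+1%:R) ^+ n <= B ->
  (1 - n%:R * (5 / m%:R ^+ 2)) * (h ^+ n * \sum_k hatn k * U k) +
    d * (h ^+ n * \sum_k hatn k * f k) - d * e * B <=
  h ^+ n * \sum_k hatn k * U' k.
Proof.
move=> h0 d0 e0 m5 U0 HU hB.
have m2 : 0 < m%:R ^+ 2 :> R by apply: lt_le_trans m5.
have hn0 : 0 <= h ^+ n by rewrite exprn_ge0.
have x0 : 0 <= 5 / m%:R ^+ 2 :> R by rewrite divr_ge0 // ltW.
have x1 : 5 / m%:R ^+ 2 <= 1 :> R by rewrite ler_pdivrMr // mul1r.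
have H1 : (1 - n%:R * (5 / m%:R ^+ 2)) * (\sum_k hatn k * U k) <=
    \sum_k hatn k * mean U k.
  rewrite /hatn mean_adj_prodf mulr_sumr; apply: ler_sum => k _.
  rewrite [leLHS]mulrA ler_wpM2r //.
  apply: le_trans (ler_wpM2r (hatn_ge0 k) (bernoulli n x0 x1)) _.
  rewrite /hatn /prodf -[X in _ ^+ X]card_ord -prodr_const -big_split /=.
  apply: ler_prod => l _; rewrite avg1_hat andbT.
  by rewrite mulr_ge0 ?hat_ge0 // subr_ge0.
have H2 : h ^+ n * \sum_k hatn k <= B.
  apply: le_trans hB; rewrite exprMn ler_wpM2l //.
  apply: le_trans (ler_sum _ (fun k _ => hatn_le1 k)) _.
  by rewrite sumr_const card_ffun !card_ord -natrX.
have H3 : \sum_k hatn k * (mean U k + d * f k - d * e) <= \sum_k hatn k * U' k.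
  apply: ler_sum => k _; have [->|kn0] := eqVneq (hatn k) 0; first by rewrite !mul0r.
  by rewrite ler_wpM2l ?hatn_ge0 // HU //; exact: hatn_inside.
apply: le_trans (ler_wpM2l hn0 H3).
have -> : \sum_k hatn k * (mean U k + d * f k - d * e) =
  \sum_k hatn k * mean U k + d * (\sum_k hatn k * f k) - d * e * (\sum_k hatn k).
  rewrite !mulr_sumr -big_split -sumrB; apply: eq_bigr => k _ /=; ring.
rewrite mulrBr mulrDr; apply: lerB; first apply: lerD.
- by rewrite mulrCA ler_wpM2l.
- by rewrite mulrCA.
- by rewrite mulrCA ler_wpM2l // mulr_ge0.
Qed.

End Mass.

(** A backward bound: the mass at early times is controlled by the last one. Going back [q] steps
    costs the factor 1 - q c, which is at least 1/2. *)
Lemma seq_decay_bound (R : realFieldType) (M : nat -> R) (c e : R) j0 i :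
  0 <= c -> 0 <= e -> i%:R * c <= 2^-1 ->
  (forall j, (j0 <= j < j0 + i)%N -> (1 - c) * M j - e <= M j.+1) ->
  (forall j, (j0 <= j <= j0 + i)%N -> 0 <= M j) ->
  forall j, (j0 <= j <= j0 + i)%N -> M j <= 2 * (M (j0 + i)%N + i%:R * e).
Proof.
move=> c0 e0 ic HM M0.
have H q : (q <= i)%N -> (1 - q%:R * c) * M (j0 + i - q)%N <= M (j0 + i)%N + q%:R * e.
  elim: q => [|q IH] qi; first by rewrite subn0 !mul0r subr0 mul1r addr0.
  have {IH} := IH (ltnW qi).
  have := HM (j0 + i - q.+1)%N; have := M0 (j0 + i - q.+1)%N.
  have -> : ((j0 + i - q.+1).+1 = j0 + i - q)%N by lia.
  move=> /(_ _) M1 /(_ _) M2 M3.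
  have {}M1 : 0 <= M (j0 + i - q.+1)%N by apply: M1; lia.
  have {}M2 : (1 - c) * M (j0 + i - q.+1)%N - e <= M (j0 + i - q)%N by apply: M2; lia.
  have q0 : 0 <= q%:R :> R by [].
  have qc : q%:R * c <= 2^-1.
    by apply: le_trans ic; rewrite ler_wpM2r // ler_nat ltnW.
  have qc0 : 0 <= q%:R * c by rewrite mulr_ge0.
  rewrite -natr1; move: (M _) (M (j0 + i - q)%N) (M (j0 + i)%N) M1 M2 M3 => x y z x0 xy yz.
  have s0 : 0 <= 1 - q%:R * c by lra.
  have := ler_wpM2l s0 xy; have := mulr_ge0 (mulr_ge0 qc0 c0) x0.
  have := mulr_ge0 qc0 e0; move: (q%:R : R) yz => Q; lra.
move=> j jj; have := H (j0 + i - j)%N; have -> : (j0 + i - (j0 + i - j) = j)%N by lia.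
move=> {}H; have {}H := H ltac:(lia).
have Mj := M0 _ jj.
have qi : (j0 + i - j)%N%:R <= i%:R :> R by rewrite ler_nat; lia.
have := ler_wpM2r e0 qi; have := ler_wpM2r c0 qi; move: H.
move: ((j0 + i - j)%N%:R) qi => q qi H1 H2 H3.
have s0 : 2^-1 <= 1 - q * c by lra.
by have := ler_wpM2r Mj s0; lra.
Qed.

(** Stands in for the convergence of a bounded monotone quantity as t tends to 0, with no limit in
    [N] taken. If no [i0] worked, [M] would drop by more than [e] along each link of a chain of
    indices, for all large [N], and the drops would add up to more than [A]. *)
Lemma oscillation_pigeonhole (R : archiRealFieldType) (M : nat -> nat -> R)
    (i1 : nat) (A e : R) : 0 < e ->
  (forall i, (i1 <= i)%N -> exists N0, forall N, (N0 <= N)%N -> 0 <= M i N <= A) ->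
  exists2 i0, (i1 <= i0)%N &
    forall i, (i0 <= i)%N -> forall N0, exists2 N, (N0 <= N)%N & M i0 N - M i N <= e.
Proof.
move=> e0 MA; apply: contrapT => noi0.
have next i0 : (i1 <= i0)%N -> exists i, (i0 <= i)%N /\
    exists N0, forall N, (N0 <= N)%N -> e < M i0 N - M i N.
  move=> i10; apply: contrapT => noi; apply: noi0; exists i0 => // i i0i N0.
  apply: contrapT => noN; apply: noi; exists i; split => //; exists N0 => N N0N.
  by rewrite ltNge; apply/negP => H; apply: noN; exists N.
have iter q : exists i, (i1 <= i)%N /\
    exists N0, forall N, (N0 <= N)%N -> q%:R * e <= M i1 N - M i N.
  elim: q => [|q [i [i1i [N0 HN]]]].
    by exists i1; split => //; exists 0 => N _; rewrite mul0r subrr.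
  have [i' [ii' [N0' HN']]] := next i i1i.
  exists i'; split; first exact: leq_trans ii'.
  exists (maxn N0 N0') => N; rewrite geq_max => /andP[/HN H1 /HN' H2].
  by rewrite -natr1 mulrDl mul1r; lra.
have [q Hq] : exists q, A < q%:R * e.
  by exists (Num.bound `|A / e|); rewrite -ltr_pdivrMr //; apply: le_lt_trans (ler_norm _) (archi_boundP (normr_ge0 _)).
have [i [i1i [N0 HN]]] := iter q.
have [N1 H1] := MA _ i1i; have [N2 H2] := MA _ (leqnn i1).
pose N := maxn N0 (maxn N1 N2).
have := HN N _; have := H1 N _; have := H2 N _.
rewrite /N !leq_max !leqnn !orbT => /(_ isT)/andP[_ a1] /(_ isT)/andP[a2 _] /(_ isT).
lra.
Qed.

(** * Consistency of the discretization *)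

Section Calculus.
Variable R : realType.

Lemma is_derive_line (V : normedModType R) (u : V -> R) (p v : V) (z : R) :
  derivable u (p + z *: v) v ->
  is_derive z 1 (fun s => u (p + s *: v)) ('D_v u (p + z *: v)).
Proof.
move=> du.
have E : (fun h : R => h^-1 *: (((fun s => u (p + s *: v)) \o shift z) (h *: 1) - u (p + z *: v))) =
         (fun h : R => h^-1 *: ((u \o shift (p + z *: v)) (h *: v) - u (p + z *: v))).
  apply/funext => h /=; congr (_ *: (u _ - _)).
  by rewrite [h *: 1]mulr1 scalerDl addrCA.
split; first by rewrite /derivable E.
by rewrite /derive E.
Qed.

(** The mean value theorem, applied to a symmetrized remainder and then to [phi1], shows that the
    second difference is [h ^+ 2] times a value of [phi2]. *)
Lemma second_difference (phi phi1 phi2 : R -> R) (h c e : R) : 0 < h ->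
  (forall z, z \in `[(- h), h] -> is_derive z 1 phi (phi1 z)) ->
  (forall z, z \in `[(- h), h] -> is_derive z 1 phi1 (phi2 z)) ->
  (forall z, z \in `[(- h), h] -> `|phi2 z - c| <= e) ->
  `|phi h + phi (- h) - 2 * phi 0 - c * h ^+ 2| <= e * h ^+ 2.
Proof.
move=> h0 D1 D2 H.
set S := phi h + phi (- h) - 2 * phi 0.
have hn0 : h != 0 by rewrite gt_eqF.
(* The coefficient of z ^ 2 is chosen so that [g] vanishes at both 0 and [h]. *)
pose g z := phi z + phi (- z) - 2 * phi 0 - S / h ^+ 2 * z ^+ 2.
pose dg z := phi1 z - phi1 (- z) - S / h ^+ 2 * (2 * z).
have Dg z : z \in `[0, h] -> is_derive z 1 g (dg z).
  rewrite in_itv /= => /andP[z0 zh].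
  have d1 : is_derive z 1 phi (phi1 z) by apply: D1; rewrite in_itv /=; apply/andP; split; lra.
  have d2 : is_derive (- z) 1 phi (phi1 (- z)) by apply: D1; rewrite in_itv /=; apply/andP; split; lra.
  have d3 : is_derive z 1 (fun z : R => - z) (- 1) by apply: is_deriveNid.
  have d4 := is_derive1_comp d2 d3.
  rewrite /g /dg; apply: is_derive_eq => /=.
  by rewrite /GRing.scale /=; ring.
have cont (f df : R -> R) (a b : R) : (forall z : R, z \in `[a, b] -> is_derive z 1 f (df z)) ->
    {within `[a, b], continuous f}.
  move=> df'; apply: derivable_within_continuous => z zab.
  exact: (@ex_derive _ _ _ _ _ _ _ (df' _ zab)).
have cg : {within `[0, h], continuous g} by exact: (cont g dg 0 h Dg).
have MV := @MVT R g dg 0 h h0.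
have Dg' (z : R) : z \in `]0, h[ -> is_derive z 1 g (dg z).
  by move=> zh; apply: Dg; exact: subset_itv_oo_cc.
have {}MV := MV Dg'.
have {}MV := MV cg.
case: MV => z1.
rewrite in_itv /= => /andP[z10 z1h].
have -> : g h - g 0 = 0 by rewrite /g /S; rewrite oppr0; field.
move/esym/eqP; rewrite subr0 mulf_eq0 (negbTE hn0) orbF => /eqP dg0.
have zz : - z1 < z1 by lra.
have D2' (z : R) : z \in `[(- z1), z1] -> is_derive z 1 phi1 (phi2 z).
  by rewrite in_itv /= => /andP[? ?]; apply: D2; rewrite in_itv /=; apply/andP; split; lra.
have D2o (z : R) : z \in `](- z1), z1[ -> is_derive z 1 phi1 (phi2 z).
  by move=> zz1; apply: D2'; exact: subset_itv_oo_cc.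
have cp := cont phi1 phi2 (- z1) z1 D2'.
have := @MVT R phi1 phi2 (- z1) z1 zz D2o cp; case=> z2.
rewrite in_itv /= => /andP[z2a z2b] E2.
have SE : S = phi2 z2 * h ^+ 2.
  have z10' : z1 != 0 by rewrite gt_eqF.
  apply/eqP; rewrite -subr_eq0; apply/eqP.
  have : (2 * z1) * (S / h ^+ 2 - phi2 z2) = 0.
    by move: dg0; rewrite /dg E2; lra.
  move/eqP; rewrite !mulf_eq0 pnatr_eq0 (negbTE z10') /= subr_eq0 => /eqP <-.
  by field.
rewrite SE -mulrBl normrM (ger0_norm (sqr_ge0 h)) ler_wpM2r ?sqr_ge0 //.
by apply: H; rewrite in_itv /=; apply/andP; split; lra.
Qed.

(** Only [p] is confined to [K]: continuity at points of [K] is in the ambient space, so [q] may lie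
    outside. *)
Lemma compact_uniform_continuity (V : normedModType R) (K : set V) (G : V -> R) (e : R) :
  compact K -> 0 < e -> (forall p, K p -> {for p, continuous G}) ->
  exists2 eta, 0 < eta & forall p q, K p -> `|p - q| < eta -> `|G p - G q| < e.
Proof.
move=> /compact_near_coveringP cK e0 cG.
have e20 : 0 < e / 2 by rewrite divr_gt0.
have : \forall eta \near (0 : R)^'+,
    K `<=` (fun p => forall q, `|p - q| < eta -> `|G p - G q| < e).
  apply: (cK _ (0 : R)^'+ (fun eta p => forall q, `|p - q| < eta -> `|G p - G q| < e)).
  move=> p Kp; have /cvgrPdist_lt/(_ _ e20) := cG p Kp.
  move=> /nbhs_ballP[r /= r0 Hr].
  have r20 : 0 < r / 2 by rewrite divr_gt0.
  exists (ball p (r / 2), [set eta | eta < r / 2]) => /=.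
    by split; [exact: nbhsx_ballx|exact: nbhs_right_lt].
  move=> [p' eta] /= [pp' etar] q p'q.
  have H1 : `|G p - G p'| < e / 2.
    by apply: Hr; apply: le_ball pp'; rewrite ler_pdivrMr //; lra.
  have H2 : `|G p - G q| < e / 2.
    apply: Hr; rewrite -ball_normE /= -(subrKA p'); apply: le_lt_trans (ler_normD _ _) _.
    by move: pp'; rewrite -ball_normE /=; lra.
  rewrite -(subrKA (G p)); apply: le_lt_trans (ler_normD _ _) _.
  by rewrite (distrC (G p')); lra.
move=> H.
have [eta [H1 H2]] : exists eta : R, 0 < eta /\ K `<=` (fun p => forall q, `|p - q| < eta -> `|G p - G q| < e).
  have : \forall eta \near (0:R)^'+, 0 < eta /\ K `<=` (fun p => forall q, `|p - q| < eta -> `|G p - G q| < e).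
    by apply: filterI H; exact: nbhs_right_gt.
  by move=> /filter_ex.
by exists eta => // p q Kp; exact: H2.
Qed.

End Calculus.

(** * Grid points and the uniform error per step *)

Section Grid.
Variables (R : realType) (n : nat).
Local Notation rV := ('rV[R]_n).

Lemma rv_normP (v : rV) (r : R) : 0 <= r ->
  reflect (forall l, `|v 0 l| <= r) (`|v| <= r).
Proof.
move=> r0; rewrite [`|v|]mx_normrE; apply: (iffP (bigmax_leP _ _ _ _)) => [[_ H] l|H].
  exact: (H (0, l)).
by split => // -[i l] _ /=; rewrite (ord1 i); exact: H.
Qed.

Lemma shift_dirt (x : rV) (t s : R) : (x, t) + s *: dirt = (x, t + s).
Proof. by congr pair; rewrite /= ?scaler0 ?addr0 // [s *: 1]mulr1. Qed.

Lemma shift_dirx i (x : rV) (t s : R) :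
  (x, t) + s *: dirx i = (x + s *: delta_mx 0 i, t).
Proof. by congr pair; rewrite /= ?scaler0 ?addr0. Qed.

Lemma norm_delta (i : 'I_n) : `|delta_mx 0 i : rV| <= 1.
Proof.
apply/rv_normP => // l; rewrite mxE eqxx /=.
by case: eqP => _; rewrite ?normr1 ?normr0.
Qed.

(** For [0 <= r], the closed ball of the sup norm, written as a product of segments for the sake of
    compactness. *)
Definition cube (x0 : rV) (r : R) : set rV :=
  [set v | forall l, `[x0 ord0 l - r, x0 ord0 l + r]%classic (v ord0 l)].

Lemma compact_cube x0 r : compact (cube x0 r).
Proof.
apply: (@rV_compact R n (fun l => `[x0 ord0 l - r, x0 ord0 l + r]%classic)) => l.
exact: segment_compact.
Qed.

Lemma cubeP x0 r x : 0 <= r -> cube x0 r x <-> `|x - x0| <= r.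
Proof.
move=> r0; split=> [H|/rv_normP H l].
  apply/rv_normP => // l; have := H l; rewrite /= in_itv /= !mxE ler_norml => /andP[? ?].
  by apply/andP; split; lra.
have := H r0 l; rewrite /= in_itv /= !mxE ler_norml => /andP[? ?].
by apply/andP; split; lra.
Qed.

Section Point.
Variables (x0 : rV) (L h : R) (m : nat).
Hypotheses (h0 : 0 < h) (hm : h * m%:R = L).
Local Notation grid := {ffun 'I_n -> 'I_m.+1}.

Implicit Types k : grid.

Definition pt (k : grid) : rV := \row_l (x0 0 l - L / 2 + h * (k l)%:R).

Lemma pt_cube k : cube x0 (L / 2) (pt k).
Proof.
move=> l; rewrite /= in_itv /= !mxE.
have H1 : 0 <= h * (k l)%:R by rewrite mulr_ge0 // ltW.
have H2 : h * (k l)%:R <= L by rewrite -hm ler_pM2l // ler_nat -ltnS.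
by apply/andP; split; lra.
Qed.

Lemma pt_ordS i k : inner (k i) ->
  pt (upd i (@ordS _) k) = pt k + h *: delta_mx 0 i.
Proof.
move=> ki; apply/rowP => l; rewrite !mxE ffunE eqxx /=; case: eqVneq => [->|li].
  by rewrite inner_ordS // -[((k i).+1)%:R]natr1 mulr1 mulrDr mulr1 addrA.
by rewrite mulr0 addr0.
Qed.

Lemma pt_ord_pred i k : inner (k i) ->
  pt (upd i (@ord_pred _) k) = pt k + (- h) *: delta_mx 0 i.
Proof.
move=> ki; apply/rowP => l; rewrite !mxE ffunE eqxx /=; case: eqVneq => [->|li].
  rewrite inner_ord_pred // mulr1.
  have -> : ((k i).-1)%:R = (k i)%:R - 1 :> R.
    by case/andP: ki => k0 _; rewrite -[in RHS](prednK k0) -natr1 addrK.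
  by rewrite mulrBr mulr1 addrA.
by rewrite mulr0 addr0.
Qed.

Lemma pt_dist (k k' : grid) l :
  pt k 0 l - pt k' 0 l = h * (k l)%:R - h * (k' l)%:R.
Proof. by rewrite !mxE; ring. Qed.

End Point.

Lemma prod_norm_le (x : rV) (t r : R) : (`|(x, t)| <= r) = (`|x| <= r) && (`|t| <= r).
Proof. by rewrite prod_normE ge_max. Qed.

(** The mean value theorem handles the time increment; [second_difference] and [mean_drift] handle
    the spatial average. Uniform continuity on the compact cylinder makes [eta] independent of the
    point. *)
Lemma parabolic_consistency (u : rV * R -> R) (x0 : rV) (L t0 T e : R) :
  0 < e ->
  C21 (cube x0 (L / 2) `*` `[t0, T]) u ->
  exists2 eta, 0 < eta & forall (h : R) (m : nat) (t : R), 0 < h -> h * m%:R = L ->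
    h < eta -> t0 <= t -> t + h ^+ 2 / 4 <= T ->
    forall k : {ffun 'I_n -> 'I_m.+1}, inside k ->
    `|u (pt x0 L h k, t + h ^+ 2 / 4) - mean (fun k => u (pt x0 L h k, t)) k
      - h ^+ 2 / 4 * (partialt u (pt x0 L h k, t) - laplacian u (pt x0 L h k, t))|
    <= h ^+ 2 / 4 * e.
Proof.
move=> e0 uC; set K := _ `*` _ in uC.
have cK : compact K by apply: compact_setX; [exact: compact_cube|exact: segment_compact].
(* Per unit of time step the time increment costs [e1] and the spatial average n (e1 + n e1):
   together [e]. *)
pose e1 := e / (1 + n%:R + n%:R ^+ 2).
have den0 : 0 < 1 + n%:R + n%:R ^+ 2 :> R.
  by rewrite -addrA; apply: ltr_pwDl => //; rewrite addr_ge0 // sqr_ge0.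
have e10 : 0 < e1 by rewrite divr_gt0.
have [etat etat0 Ht] : exists2 eta, 0 < eta & forall p q, K p -> `|p - q| < eta ->
    `|partialt u p - partialt u q| < e1.
  by apply: compact_uniform_continuity => // p /uC[_ []].
have Hx i : exists eta, 0 < eta /\ forall p q, K p -> `|p - q| < eta ->
    `|partialx i (partialx i u) p - partialx i (partialx i u) q| < e1.
  have [|eta ? ?] := @compact_uniform_continuity R _ K (partialx i (partialx i u)) e1 cK e10.
    by move=> p /uC[_ _ _ /(_ i i)[]].
  by exists eta.
have [etax Hetax] := choice Hx.
(* The bound [h < 1] makes the time step at most [h], so that [h < etat] also controls time
   shifts. *)
pose eta := Num.min etat (Num.min 1 (\big[Num.min/1]_i etax i)).
exists eta.
  rewrite !lt_min etat0 ltr01 /=; apply: lt_bigmin => // i _; exact: (Hetax i).1.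
move=> h m t h0 hm; rewrite !lt_min => /and3P[hetat h1 hetax] t0t tT k ik.
set d := h ^+ 2 / 4 in tT *.
have d0 : 0 < d by rewrite divr_gt0 // exprn_gt0.
have dh : d <= h by rewrite /d; nra.
have Kpt (k' : {ffun 'I_n -> 'I_m.+1}) s : 0 <= s -> s <= d -> K (pt x0 L h k', t + s).
  move=> s0 sd; split => /=; first exact: (pt_cube x0 h0 hm).
  by rewrite in_itv /=; apply/andP; split; lra.
have Kpt0 (k' : {ffun 'I_n -> 'I_m.+1}) : K (pt x0 L h k', t) by rewrite -[t]addr0; apply: Kpt => //; exact: ltW.
have etaxi i : h < etax i by apply: lt_le_trans hetax _; exact: bigmin_le.
have Htime : `|u (pt x0 L h k, t + d) - u (pt x0 L h k, t) - d * partialt u (pt x0 L h k, t)| <= d * e1.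
  pose p := (pt x0 L h k, t).
  have D (s : R) : s \in `[0, d] -> is_derive s 1 (fun s => u (p + s *: dirt)) (partialt u (p + s *: dirt)).
    rewrite in_itv /= => /andP[s0 sd]; apply: is_derive_line.
    by rewrite shift_dirt; have [_ []] := uC _ (Kpt k _ s0 sd).
  have Do (s : R) : s \in `]0, d[ -> is_derive s 1 (fun s => u (p + s *: dirt)) (partialt u (p + s *: dirt)).
    by move=> ?; apply: D; exact: subset_itv_oo_cc.
  have C : {within `[0, d], continuous (fun s => u (p + s *: dirt))}.
    apply: derivable_within_continuous => z zab.
    exact: (@ex_derive _ _ _ _ _ _ _ (D _ zab)).
  have := @MVT R _ _ 0 d d0 Do C; case=> s; rewrite in_itv /= => /andP[s0 sd].
  rewrite !shift_dirt addr0 subr0 => ->.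
  rewrite [_ * d]mulrC -mulrBr normrM (gtr0_norm d0) ler_pM2l // distrC.
  apply/ltW/Ht => //.
  have -> : (pt x0 L h k, t) - (pt x0 L h k, t + s) = (0, - s).
    by congr pair => /=; [rewrite subrr|ring].
  apply: le_lt_trans hetat; apply: le_trans dh.
  by rewrite prod_norm_le normr0 normrN (gtr0_norm s0) (ltW d0) (ltW sd).
have Hspace : `|mean (fun k => u (pt x0 L h k, t)) k - u (pt x0 L h k, t) -
    \sum_i d * partialx i (partialx i u) (pt x0 L h k, t)| <= n%:R * (d * e1 + n%:R * (d * e1)).
  have close i (p : rV * R) z : `|z| <= h -> `|p - (p + z *: dirx i)| <= h.
    move=> zh; rewrite opprD addrA subrr sub0r normrN normrZ.
    apply: le_trans zh; rewrite ler_piMr // /dirx prod_norm_le normr0 ler01 andbT.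
    exact: norm_delta.
  have Kline i (k' : {ffun 'I_n -> 'I_m.+1}) z : inner (k' i) -> `|z| <= h ->
      K ((pt x0 L h k', t) + z *: dirx i).
    move=> /andP[k0 km] zh; rewrite shift_dirx; split; last exact: (Kpt0 k').2.
    move=> l; have := pt_cube x0 h0 hm k' l.
    rewrite /= !in_itv /= !mxE eqxx /=; case: eqVneq => [->|_]; last by rewrite mulr0 addr0.
    have H1 : h <= h * (k' i)%:R by rewrite ler_peMr ?ler1n // ltW.
    have H2 : h * (k' i)%:R + h <= L.
      by rewrite -hm -[X in _ + X]mulr1 -mulrDr ler_pM2l // natr1 ler_nat.
    move=> _; move: zh; rewrite mulr1 ler_norml => /andP[z1 z2].
    by apply/andP; split; lra.
  have de0 : 0 <= d * e1 by rewrite mulr_ge0 // ltW.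
  apply: (@mean_drift R n m (fun k => u (pt x0 L h k, t))
    (fun i k => d * partialx i (partialx i u) (pt x0 L h k, t))) => //.
    move=> i k' ki; pose p := (pt x0 L h k', t).
    have zh (z : R) : z \in `[(- h), h] -> `|z| <= h by rewrite in_itv /= ler_norml.
    have S := @second_difference R (fun z => u (p + z *: dirx i))
      (fun z => partialx i u (p + z *: dirx i))
      (fun z => partialx i (partialx i u) (p + z *: dirx i)) h
      (partialx i (partialx i u) p) e1 h0.
    have {}S : `|u (p + h *: dirx i) + u (p + (- h) *: dirx i) - 2 * u (p + 0 *: dirx i) -
         partialx i (partialx i u) p * h ^+ 2| <= e1 * h ^+ 2.
      apply: S => z /zh zh'.
      - apply: is_derive_line; have [_ _ /(_ i)[] //] := uC _ (Kline i k' z ki zh').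
      - apply: is_derive_line; have [_ _ _ /(_ i i)[] //] := uC _ (Kline i k' z ki zh').
      - rewrite distrC; apply/ltW/((Hetax i).2 p _ (Kpt0 k')).
        exact: le_lt_trans (close i p z zh') (etaxi i).
    rewrite /avg /= pt_ordS // pt_ord_pred //.
    move: S; rewrite scale0r addr0 !shift_dirx -/p => S.
    rewrite (_ : _ - _ - _ = 4^-1 * (u (pt x0 L h k' + h *: delta_mx 0 i, t) +
      u (pt x0 L h k' + - h *: delta_mx 0 i, t) - 2 * u p -
      partialx i (partialx i u) p * h ^+ 2)); last by rewrite /d; field.
    rewrite normrM ger0_norm // (_ : d * e1 = 4^-1 * (e1 * h ^+ 2)); last by rewrite /d; field.
    by rewrite ler_wpM2l.
  move=> i l k' ki; pose p := (pt x0 L h k', t).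
  have hh : `|h| <= h by rewrite gtr0_norm.
  have hh' : `|- h| <= h by rewrite normrN gtr0_norm.
  have H1 := (Hetax l).2 p _ (Kpt0 k') (le_lt_trans (close i p _ hh) (etaxi l)).
  have H2 := (Hetax l).2 p _ (Kpt0 k') (le_lt_trans (close i p _ hh') (etaxi l)).
  rewrite /p [(_, t) + _]shift_dirx in H1; rewrite /p [(_, t) + _]shift_dirx in H2.
  rewrite /avg (pt_ordS _ _ _ ki) (pt_ord_pred _ _ _ ki).
  move: H1 H2; move: (partialx l _) => G.
  set a := G (pt _ _ _ _, t); set b := G (_ + - h *: _, _); set c := G (_ + h *: _, _).
  rewrite !ltr_norml => /andP[c1 c2] /andP[b1 b2].
  rewrite (_ : _ - _ = d * ((c + b - 2 * a) / 4)); last by field.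
  rewrite normrM (gtr0_norm d0) ler_pM2l // ler_norml.
  by apply/andP; split; lra.
have ee : e = e1 + n%:R * (e1 + n%:R * e1) by rewrite /e1; field; rewrite gt_eqF.
rewrite -mulr_sumr -/(laplacian u _) in Hspace.
move: Htime Hspace; set A := u (_, t + d); set B := u (_, t); set M := mean _ _.
set P := partialt _ _; set S := laplacian _ _ => H1 H2.
rewrite (_ : _ - _ = (A - B - d * P) - (M - B - d * S)); last by ring.
apply: le_trans (ler_normB _ _) _; apply: le_trans (lerD H1 H2) _.
by rewrite [in leRHS]ee le_eqVlt; apply/orP; left; apply/eqP; ring.
Qed.

End Grid.

(** * Concentration estimate *)

(** With [nu] the n-th root of [x] the critical power becomes x nu ^ 2; 1 / nu is the length scale
    at height [x]. *)
Lemma powR_root (R : realType) (n : nat) (x : R) : (0 < n)%N -> 0 < x ->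
  exists2 nu, 0 < nu & nu ^+ n = x /\ x `^ (1 + 2 / n%:R) = x * nu ^+ 2.
Proof.
move=> n0 x0; exists (x `^ n%:R^-1); first by rewrite powR_gt0.
have nn : n%:R != 0 :> R by rewrite pnatr_eq0 -lt0n.
split; first by rewrite -powR_mulrn ?powR_ge0 // -powRrM mulVf // powRr1 // ltW.
rewrite powRD; last by rewrite gt_eqF // implybT.
rewrite powRr1 ?ltW //; congr (_ * _).
by rewrite -powR_mulrn ?powR_ge0 // -powRrM mulrC.
Qed.

Section Concentration.
Variables (R : realType) (n : nat) (A : R).
Hypotheses (n0 : (0 < n)%N) (A0 : 0 <= A).

(** Lengths are in units of 1 / nu. [source_const] comes from U + 1 <= 2 ^ (n + 1) ub. [short_ratio]
    brings the recent sources below ub / 8; so does [horizon_ratio] for the initial mass, its n-th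
    power being at least 2 ^ n (8 A + 1). [radius_ratio] brings the paraboloid term below ub / 4. *)
Definition source_const : R := (2 ^+ n.+1) `^ (1 + 2 / n%:R).
Definition short_ratio : R := (8 * source_const)^-1.
Definition horizon_ratio : R := 2 * (8 * A + 1).
Definition radius_ratio : R := 8 * n%:R * 2 ^+ n * horizon_ratio.

(** Chosen so that 2 ^ n times it, divided by [short_ratio ^+ n], is 1/8. *)
Definition small_mass : R := short_ratio ^+ n / (2 ^+ n * 8).
(** The factor 4 makes the radius less than a quarter of the distance to the boundary. *)
Definition blowup_const : R := 4 * radius_ratio.

Lemma source_const_ge1 : 1 <= source_const.
Proof.
apply: (@le_trans _ _ (1 `^ (1 + 2 / n%:R))); first by rewrite powR1.
rewrite /source_const; apply: ge0_ler_powR.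
- by rewrite addr_ge0 // divr_ge0.
- by rewrite nnegrE.
- by rewrite nnegrE exprn_ge0.
- by apply: exprn_ege1; rewrite ler1n.
Qed.

Lemma short_ratio_gt0 : 0 < short_ratio.
Proof. by rewrite /short_ratio invr_gt0 mulr_gt0 //; apply: lt_le_trans source_const_ge1. Qed.

Lemma horizon_ratio_ge1 : 1 <= horizon_ratio.
Proof. by move: A0; rewrite /horizon_ratio => ?; lra. Qed.

Lemma horizon_le_radius : horizon_ratio <= radius_ratio.
Proof.
have g1 := horizon_ratio_ge1; rewrite /radius_ratio; apply: ler_peMl; first exact: le_trans ler01 g1.
have H1 : 1 <= n%:R :> R by rewrite ler1n.
have H2 : 1 <= 2 ^+ n :> R by apply: exprn_ege1; rewrite ler1n.
nra.
Qed.

Lemma small_mass_gt0 : 0 < small_mass.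
Proof. by rewrite /small_mass divr_gt0 ?mulr_gt0 ?exprn_gt0 // short_ratio_gt0. Qed.

Lemma source_bound (ub nu U : R) : 1 <= ub -> 0 < nu -> nu ^+ n = ub ->
  ub `^ (1 + 2 / n%:R) = ub * nu ^+ 2 ->
  0 <= U -> U <= 2 ^+ n * ub -> (U + 1) `^ (1 + 2 / n%:R) <= source_const * (ub * nu ^+ 2).
Proof.
move=> ub1 nu0 nun <- U0 UM.
have ub0 : 0 <= ub by apply: le_trans ub1.
rewrite /source_const -powRM ?exprn_ge0 //; apply: ge0_ler_powR.
- by rewrite addr_ge0 // divr_ge0.
- by rewrite nnegrE addr_ge0.
- by rewrite nnegrE mulr_ge0 ?exprn_ge0.
- have H2 : 1 <= 2 ^+ n :> R by apply: exprn_ege1; rewrite ler1n.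
  by rewrite exprS; nra.
Qed.

(* All terms scale like [ub]: with [nu = ub ^ (1/n)], the time horizon is
   [(horizon_ratio / nu) ^ 2] and the radius [radius_ratio / nu]. *)
Lemma final_contradiction (ub nu h d S0 S1 J r0 : R) :
  1 <= ub -> 0 < nu -> nu ^+ n = ub -> 0 < h ->
  0 <= J * d -> J * d <= (horizon_ratio / nu) ^+ 2 -> J * d <= 1 -> r0 * d <= (short_ratio / nu) ^+ 2 ->
  h ^+ n * S0 <= 2 ^+ n * A -> h ^+ n * S1 <= 2 ^+ n * small_mass ->
  ub - 2 ^+ n * ub * (2 * n%:R * (J * d)) / (radius_ratio / nu) ^+ 2 <=
    (h / (horizon_ratio / nu)) ^+ n * S0 + r0 * d * (source_const * (ub * nu ^+ 2)) +
    (h / (short_ratio / nu)) ^+ n * S1 + J * d * 8^-1 -> False.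
Proof.
move=> ub1 nu0 nun h0 Jd0 JH Jd1 rd HS0 HS1.
have A0' := A0; have ub0 : 0 < ub by apply: lt_le_trans ub1.
have nu_neq0 : nu != 0 by rewrite gt_eqF.
have g1 := horizon_ratio_ge1; have g0 : 0 < horizon_ratio by apply: lt_le_trans g1.
have c0 := short_ratio_gt0; have C31 := source_const_ge1.
have n1 : 1 <= n%:R :> R by rewrite ler1n.
have p1 : 1 <= 2 ^+ n :> R by apply: exprn_ege1; rewrite ler1n.
have p0 : 0 < 2 ^+ n :> R by apply: lt_le_trans p1.
have T0 : 2 ^+ n * ub * (2 * n%:R * (J * d)) / (radius_ratio / nu) ^+ 2 <= ub / 4.
  have K0 : 0 < radius_ratio by apply: lt_le_trans horizon_le_radius.
  have Kn0 : 0 < (radius_ratio / nu) ^+ 2 by rewrite exprn_gt0 // divr_gt0.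
  rewrite ler_pdivrMr //.
  apply: (@le_trans _ _ (2 ^+ n * ub * (2 * n%:R * (horizon_ratio / nu) ^+ 2))).
    have q0 : 0 < 2 ^+ n * ub by exact: mulr_gt0.
    by rewrite (ler_pM2l q0) ler_wpM2l // mulr_ge0.
  have -> : ub / 4 * (radius_ratio / nu) ^+ 2 = (16 * n%:R ^+ 2 * (2 ^+ n) ^+ 2) * (ub * (horizon_ratio / nu) ^+ 2).
    by rewrite /radius_ratio; field.
  have -> : 2 ^+ n * ub * (2 * n%:R * (horizon_ratio / nu) ^+ 2) = (2 * n%:R * 2 ^+ n) * (ub * (horizon_ratio / nu) ^+ 2).
    by field.
  have gn0 : 0 <= ub * (horizon_ratio / nu) ^+ 2 by apply: mulr_ge0; [exact: ltW|exact: sqr_ge0].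
  apply: (ler_wpM2r gn0).
  have z1 : 1 <= n%:R * 2 ^+ n :> R by exact: mulr_ege1.
  rewrite -[leLHS]mulrA (_ : 16 * _ * _ = 16 * (n%:R * 2 ^+ n) ^+ 2); last by ring.
  by move: (n%:R * 2 ^+ n) z1 => z z1; nra.
(* Scale invariance: [ub = nu ^+ n] comes out as a factor of the mass [h ^+ n * S]. *)
have scal (y S : R) : 0 < y -> (h / (y / nu)) ^+ n * S = ub / y ^+ n * (h ^+ n * S).
  by move=> y0; rewrite -nun !expr_div_n; field; rewrite !expf_neq0 // gt_eqF.
rewrite !scal //.
have T1 : ub / horizon_ratio ^+ n * (h ^+ n * S0) <= ub / 8.
  apply: (@le_trans _ _ (ub / horizon_ratio ^+ n * (2 ^+ n * A))).
    by rewrite ler_pM2l // divr_gt0 // exprn_gt0.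
  have -> : horizon_ratio ^+ n = 2 ^+ n * (8 * A + 1) ^+ n by rewrite /horizon_ratio exprMn.
  have G1 : 1 <= 8 * A + 1 by lra.
  have G : 8 * A + 1 <= (8 * A + 1) ^+ n by exact: ler_eXnr.
  have Gn0 : 0 < (8 * A + 1) ^+ n by apply: lt_le_trans G; lra.
  rewrite (_ : _ * _ = ub * (A / (8 * A + 1) ^+ n)); last by field; rewrite !gt_eqF.
  by rewrite ler_pM2l // ler_pdivrMr //; lra.
have T2 : r0 * d * (source_const * (ub * nu ^+ 2)) <= ub / 8.
  apply: (@le_trans _ _ ((short_ratio / nu) ^+ 2 * (source_const * (ub * nu ^+ 2)))).
    by rewrite ler_wpM2r // !mulr_ge0 ?sqr_ge0 ?ltW //; lra.
  have -> : (short_ratio / nu) ^+ 2 * (source_const * (ub * nu ^+ 2)) = ub * (64 * source_const)^-1.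
    by rewrite /short_ratio; field; rewrite nu_neq0 gt_eqF //; lra.
  by rewrite ler_pM2l // lef_pV2 ?posrE ?mulr_gt0 //; lra.
have T3 : ub / short_ratio ^+ n * (h ^+ n * S1) <= ub / 8.
  apply: (@le_trans _ _ (ub / short_ratio ^+ n * (2 ^+ n * small_mass))).
    by rewrite ler_pM2l // divr_gt0 // exprn_gt0.
  rewrite /small_mass le_eqVlt; apply/orP; left; apply/eqP.
  by field; rewrite !expf_neq0 // gt_eqF.
have T4 : J * d * 8^-1 <= ub / 8 by lra.
(* The five terms add up to at most ub / 4 + 4 ub / 8 < ub. *)
move=> H; have {}H := le_trans H (lerD (lerD (lerD T1 T2) T3) T4).
by lra.
Qed.

End Concentration.

(* The parabolic distance to the lateral boundary and the bottom of the
   cylinder of centre [x0], side [L / 2] and initial time [tl]. *)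
Definition bdist {R : realType} {n : nat} (x0 : 'rV[R]_n) (L tl : R)
    (x : 'rV[R]_n) (t : R) : R :=
  Num.max 0 (Num.min (Num.sqrt (t - tl)) (L / 4 - `|x - x0|)).

(** The maximization runs over one finite grid, so a maximum point exists. The bound involves only
    [n] and [A], so it survives refinement and [tl] tending to 0. *)
Lemma grid_blowup_bound (R : realType) (n : nat) (A : R) (x0 : 'rV[R]_n)
    (L h d tl Umax : R) (m jl jh : nat)
    (U f : nat -> {ffun 'I_n -> 'I_m.+1} -> R) :
  (0 < n)%N -> 0 <= A -> (0 < m)%N -> 0 < h -> h * m%:R = L -> d = h ^+ 2 / 4 ->
  jl%:R * d = tl -> 0 <= tl -> jh%:R * d <= 1 ->
  (forall j k, (jl <= j <= jh)%N -> 0 <= U j k <= Umax) ->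
  h * Umax <= radius_ratio n A ->
  (forall j k, (jl <= j < jh)%N -> 0 <= f j k <= (U j k + 1) `^ (1 + 2 / n%:R)) ->
  (forall j k, (jl <= j < jh)%N -> inside k ->
     U j.+1 k <= mean (U j) k + d * f j k + d * 8^-1) ->
  (forall j, (jl <= j <= jh)%N -> h ^+ n * (\sum_k hatn R k * U j k) <= A) ->
  \sum_(jl <= j < jh) d * (h ^+ n * \sum_k hatn R k * f j k) <= small_mass R n ->
  forall j k, (jl <= j <= jh)%N ->
    bdist x0 L tl (pt x0 L h k) (j%:R * d) ^+ n * U j k <= blowup_const n A ^+ n.
Proof.
move=> n0 A0 m0 h0 hm dE jltl tl0 jh1 UU hU ff US Umass fmass j k jj.
rewrite leNgt; apply/negP => big.
pose val (p : {ffun 'I_n -> 'I_m.+1} * 'I_jh.+1) :=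
  bdist x0 L tl (pt x0 L h p.1) (p.2%:R * d) ^+ n * U p.2 p.1.
have jjh : (j < jh.+1)%N by case/andP: jj.
have jlj : (jl <= j)%N by case/andP: jj.
pose p0 : {ffun 'I_n -> 'I_m.+1} * 'I_jh.+1 := (k, Ordinal jjh).
have Pp0 : (jl <= p0.2)%N by [].
have [[kb jb] /= jlb maxb] :=
  @Order.TotalTheory.arg_maxP _ _ _ p0 (fun p => jl <= p.2)%N val Pp0.
have jbh : (jb <= jh)%N by rewrite -ltnS.
have bigb : blowup_const n A ^+ n < val (kb, jb) by apply: lt_le_trans big (maxb p0 Pp0).
have maxv k' j' : (jl <= j' <= jh)%N ->
    bdist x0 L tl (pt x0 L h k') (j'%:R * d) ^+ n * U j' k' <= val (kb, jb).
  move=> /andP[jlj' jjh']; have jjh2 : (j' < jh.+1)%N by [].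
  exact: (maxb (k', Ordinal jjh2) jlj').
clear big k j jj p0 Pp0 jjh jlj.
move: bigb maxv; rewrite /val /=; move: (nat_of_ord jb) jlb jbh => {maxb}{}jb jlb jbh.
set D := bdist _ _ _ _ _; set ub := U jb kb => bigb maxv.
have d0 : 0 < d by rewrite dE divr_gt0 // exprn_gt0.
have g1 := horizon_ratio_ge1 A0; have gK := horizon_le_radius n0 A0.
set g := horizon_ratio A in g1 gK; set K := radius_ratio n A in gK hU.
have K1 : 1 <= K by exact: le_trans gK.
have BE : blowup_const n A = 4 * K by [].
have /andP[ub0 ubU] : 0 <= ub <= Umax by apply: UU; rewrite jlb.
have D0 : 0 < D.
  rewrite lt_neqAle le_max lexx andbT; apply: contraTneq bigb => <-.
  by rewrite expr0n -[n == 0%N]negbK -lt0n n0 mul0r -leNgt exprn_ge0 // BE; lra.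
have DE : D = Num.min (Num.sqrt (jb%:R * d - tl)) (L / 4 - `|pt x0 L h kb - x0|).
  move: D0; rewrite /D /bdist lt_max ltxx /= => H; rewrite max_r //; exact: ltW.
have Dx : D <= L / 4 - `|pt x0 L h kb - x0| by rewrite DE ge_min lexx orbT.
have Dt : D ^+ 2 <= jb%:R * d - tl.
  have Ds : D <= Num.sqrt (jb%:R * d - tl) by rewrite DE ge_min lexx.
  have s0 : 0 < jb%:R * d - tl by rewrite -sqrtr_gt0; exact: lt_le_trans Ds.
  by rewrite -[leRHS]sqr_sqrtr ?(ltW s0) // ler_sqr ?nnegrE ?sqrtr_ge0 ?(ltW D0).
have jbd1 : jb%:R * d <= 1 by apply: le_trans jh1; rewrite ler_wpM2r ?ler_nat // ltW.
(* From [D <= 1] follows [ub >= 1]; comparing n-th roots then gives [4 * K < D * nu], the room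
   needed for the cylinder. *)
have D1 : D <= 1 by rewrite -(@expr_le1 _ 2) //; [lra|exact: ltW].
have B1 : 1 <= blowup_const n A ^+ n by apply: exprn_ege1; rewrite BE; lra.
have ub1 : 1 <= ub.
  have : D ^+ n <= 1 by apply: exprn_ile1 => //; exact: ltW.
  move: bigb; move: (D ^+ n) (exprn_ge0 n (ltW D0)) => x x0' H1 H2; nra.
have [nu nu0 [nun nup]] := powR_root n0 (lt_le_trans ltr01 ub1).
have nuD : 4 * K < D * nu.
  rewrite ltNge; apply/negP => H; have : (D * nu) ^+ n <= blowup_const n A ^+ n.
    by apply: lerXn2r => //; rewrite nnegrE ?BE; [rewrite mulr_ge0 // ltW|lra].
  by rewrite exprMn nun leNgt bigb.
have nu1 : 1 <= nu by nra.
have nuub : nu <= ub by rewrite -nun; exact: ler_eXnr.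
have [rho rhoE] : {rho | rho = K / nu} by exists (K / nu).
have [y yE] : {y | y = g / nu} by exists (g / nu).
have c0 := short_ratio_gt0 R n; set c := short_ratio R n in c0.
have [z zE] : {z | z = c / nu} by exists (c / nu).
have rho0 : 0 < rho by rewrite rhoE divr_gt0 //; lra.
have rhoD : 4 * rho < D by rewrite rhoE mulrA ltr_pdivrMr.
have hrho : h <= rho.
  rewrite rhoE ler_pdivlMr //; apply: le_trans hU; rewrite ler_pM2l //.
  exact: le_trans ubU.
have yrho : y <= rho by rewrite yE rhoE ler_pM2r ?invr_gt0.
have y0 : 0 < y by rewrite yE divr_gt0 //; lra.
have z0 : 0 < z by rewrite zE divr_gt0.
have HD : y ^+ 2 <= D ^+ 2 / 16.
  have : 4 * y <= D by lra.
  rewrite -ler_sqr ?nnegrE ?mulr_ge0 ?(ltW D0) ?(ltW y0) // exprMn.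
  by move: (y ^+ 2) (D ^+ 2); clear; move=> *; lra.
(* Rounding down keeps [J] steps within the horizon, while [J.+1] steps exceed it, which the kernel
   bound uses. *)
have [J [JH HJ]] : exists J : nat, J%:R * d <= y ^+ 2 /\ y ^+ 2 < J.+1%:R * d.
  exists (Num.truncn (y ^+ 2 / d)).
  have /andP[] := @truncn_itv R (y ^+ 2 / d) (divr_ge0 (sqr_ge0 _) (ltW d0)).
  by rewrite ler_pdivlMr // ltr_pdivrMr.
have [r0 [rc cr]] : exists r : nat, r%:R * d <= z ^+ 2 /\ z ^+ 2 < r.+1%:R * d.
  exists (Num.truncn (z ^+ 2 / d)).
  have /andP[] := @truncn_itv R (z ^+ 2 / d) (divr_ge0 (sqr_ge0 _) (ltW d0)).
  by rewrite ler_pdivlMr // ltr_pdivrMr.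
have D20 : 0 < D ^+ 2 by rewrite exprn_gt0.
have Jb : (J <= jb - jl)%N.
  rewrite leq_subRL // -(@ler_nat R) natrD -(ler_pM2r d0) mulrDl jltl.
  by move: JH HD D20 Dt; move: (J%:R * d) (jb%:R * d) (D ^+ 2) (y ^+ 2); clear; move=> *; lra.
have Jjb : (J <= jb)%N by move: Jb; clear; lia.
pose M := 2 ^+ n * ub.
(* Within [2 * rho < D / 2] in space and D ^ 2 / 16 in time, the distance to the boundary stays at
   least [D / 2]; maximality then gives [U <= 2 ^+ n * ub]. *)
have dist_half j (k : {ffun 'I_n -> 'I_m.+1}) : (jb - J <= j <= jb)%N ->
    (forall l, `|h * (k l)%:R - h * (kb l)%:R| <= 2 * rho) ->
    D / 2 <= bdist x0 L tl (pt x0 L h k) (j%:R * d).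
  move=> /andP[j1 j2] kk; rewrite /bdist le_max le_min; apply/orP; right; apply/andP; split.
    have : (D / 2) ^+ 2 <= j%:R * d - tl.
      have : jb%:R * d - J%:R * d <= j%:R * d.
        by rewrite -mulrBl ler_pM2r // -natrB // ler_nat.
      move: JH HD D20 Dt; move: (J%:R * d) (jb%:R * d) (j%:R * d) (y ^+ 2).
      by rewrite expr_div_n; move: (D ^+ 2); clear; move=> *; lra.
    move=> Hs; apply: le_trans (ler_wsqrtr Hs); rewrite sqrtr_sqr.
    exact: ler_norm.
  have : `|pt x0 L h k - pt x0 L h kb| <= 2 * rho.
    apply/rv_normP => [|l]; first by rewrite mulr_ge0 // ltW.
    by have := pt_dist x0 L h k kb l; rewrite !mxE => ->.
  have := ler_normD (pt x0 L h k - pt x0 L h kb) (pt x0 L h kb - x0).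
  rewrite addrA subrK; move: Dx rhoD.
  move: `|pt x0 L h k - pt x0 L h kb| `|pt x0 L h kb - x0| `|pt x0 L h k - x0|.
  by clear; move=> *; lra.
have far j (k : {ffun 'I_n -> 'I_m.+1}) : (jb - J <= j <= jb)%N ->
    (forall l, `|h * (k l)%:R - h * (kb l)%:R| <= 2 * rho) -> 0 <= U j k <= M.
  move=> jj kk; have jj' : (jl <= j <= jh)%N by move: jj Jb jlb jbh; clear; lia.
  have /andP[U0 _] := UU j k jj'; rewrite U0 /=.
  have := maxv k j jj'; have := dist_half j k jj kk.
  move: (bdist _ _ _ _ _) => x Dx2 H1.
  have D2p : 0 < D / 2 by rewrite divr_gt0.
  have H2 : (D / 2) ^+ n * U j k <= D ^+ n * ub.
    apply: le_trans H1; rewrite ler_wpM2r //; apply: lerXn2r => //; rewrite nnegrE ?(ltW D2p) //.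
    exact: le_trans (ltW D2p) Dx2.
  have Dn : 0 < D ^+ n by rewrite exprn_gt0.
  by move: H2; rewrite expr_div_n mulrAC ler_pdivrMr ?exprn_gt0 // -mulrA ler_pM2l // mulrC.
pose B (k : {ffun 'I_n -> 'I_m.+1}) := [forall l, `|h * (k l)%:R - h * (kb l)%:R| < rho].
(* These points are within [L / 4] of [x0] in each coordinate, the middle half of the grid, where
   the cutoff is at least 2 ^ (-n). *)
have mid k : B k ->
    forall l, m%:R <= 4 * (k l)%:R :> R /\ 4 * (k l)%:R <= 3 * m%:R :> R.
  move=> /forallP kk l; have := kk l; rewrite ltr_norml => /andP[k1 k2].
  have : `|pt x0 L h kb - x0| <= L / 4 - D by rewrite lerBrDr addrC -lerBrDr.
  move=> Dx'; have /rv_normP := Dx' => /(_ _ l); rewrite !mxE ler_norml => HH.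
  have /andP[k3 k4] := HH (le_trans (normr_ge0 _) Dx').
  have Lk : L / 4 < h * (k l)%:R /\ h * (k l)%:R < 3 * L / 4.
    move: rhoD k1 k2 k3 k4; move: (h * (k l)%:R) (h * (kb l)%:R) (x0 0 l).
    by clear -rho0; move=> *; lra.
  by split; rewrite -(ler_pM2l h0) ![h * (_ * _)]mulrCA ?hm; move: Lk; clear; lra.
have ins k : B k -> inside k.
  move=> kk l; have [k1 k2] := mid k kk l.
  have k1' : (m <= 4 * k l)%N by rewrite -(ler_nat R) natrM.
  have k2' : (4 * k l <= 3 * m)%N by rewrite -(ler_nat R) !natrM.
  by rewrite /inner; move: k1' k2' m0; clear; lia.
have dh : d <= h ^+ 2 by rewrite dE ler_pdivrMr // ler_peMr ?sqr_ge0 // ler1n.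
have y1 : y ^+ 2 <= J.*2.+1%:R * h ^+ 2.
  apply: le_trans (ltW HJ) _; apply: ler_pM => //; first exact: ltW.
  by rewrite ler_nat ltnS -addnn leq_addr.
have y2 : z ^+ 2 <= r0.*2.+1%:R * h ^+ 2.
  apply: le_trans (ltW cr) _; apply: ler_pM => //; first exact: ltW.
  by rewrite ler_nat ltnS -addnn leq_addr.
have closeU j k : B k -> (jb - J <= j <= jb)%N -> 0 <= U j k <= M.
  move=> /forallP kk jj; apply: far => // l; apply: le_trans (ltW (kk l)) _.
  by rewrite ler_peMl ?ltW // ltr1n.
have C1 := source_const_ge1 R n.
pose F := source_const R n * (ub * nu ^+ 2).
have C0 : 0 <= source_const R n by exact: le_trans ler01 C1.
have F0 : 0 <= F by apply: mulr_ge0 => //; apply: mulr_ge0 => //; exact: sqr_ge0.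
have e80 : 0 <= 8^-1 :> R by [].
have idx (j : nat) : (j < J)%N -> (jl <= jb - J + j < jh)%N /\ (jb - J <= jb - J + j <= jb)%N.
  by move: Jb Jjb jbh; clear; lia.
have LMU j (k : {ffun 'I_n -> 'I_m.+1}) : (j <= J)%N -> (forall l, `|h * (k l)%:R - h * (kb l)%:R| <= 2 * rho) ->
    0 <= U (jb - J + j)%N k <= M.
  by move=> jJ; apply: far; move: jJ Jjb; clear; lia.
have LMf j k : (j < J)%N -> B k -> 0 <= f (jb - J + j)%N k <= F.
  move=> jJ Bk; have [jj1 jj2] := idx j jJ.
  have /andP[-> fk] := ff _ k jj1; have /andP[U0 UM] := closeU _ _ Bk jj2.
  by apply: le_trans fk _; exact: source_bound.
have LMS j k : (j < J)%N -> B k ->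
    U (jb - J + j.+1)%N k <= mean (U (jb - J + j)%N) k + d * f (jb - J + j)%N k + d * 8^-1.
  by move=> jJ Bk; rewrite addnS; apply: US; [exact: (idx j jJ).1|exact: ins].
have LM := @local_max_principle R n m (fun j => U (jb - J + j)%N)
  (fun j => f (jb - J + j)%N) kb J r0 h d rho M y z 8^-1 F
  dE h0 hrho y0 z0 e80 F0 y1 y2 ins LMU LMf LMS.
rewrite /= subnK // addn0 -/ub in LM.
have hat_low k : B k -> 2^-1 ^+ n <= hatn R k.
  by move=> Bk; apply: hatn_mid => //; exact: mid.
have sumB (w : {ffun 'I_n -> 'I_m.+1} -> R) : (forall k, 0 <= w k) ->
    \sum_(k | B k) w k <= 2 ^+ n * \sum_k hatn R k * w k.
  move=> w0; rewrite mulr_sumr big_mkcond; apply: ler_sum => k _.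
  case: ifP => Bk; last by rewrite !mulr_ge0 ?exprn_ge0 ?hatn_ge0.
  rewrite mulrA ler_peMl //; have := hat_low k Bk.
  by rewrite exprVn => H; rewrite mulrC -ler_pdivrMr ?exprn_gt0 // mul1r.
have hn0 : 0 <= h ^+ n by rewrite exprn_ge0 // ltW.
have HS0 : h ^+ n * (\sum_(k | B k) U (jb - J)%N k) <= 2 ^+ n * A.
  have jJ : (jl <= jb - J <= jh)%N by move: Jb Jjb jbh jlb; clear; lia.
  apply: le_trans (ler_wpM2l hn0 (sumB _ _)) _.
    by move=> k; have /andP[] := UU _ k jJ.
  by rewrite mulrCA ler_wpM2l ?exprn_ge0 // Umass.
have HS1 : h ^+ n * (\sum_(j < J) d * \sum_(k | B k) f (jb - J + j)%N k) <= 2 ^+ n * small_mass R n.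
  apply: (@le_trans _ _ (2 ^+ n * \sum_(j < J) d * (h ^+ n * \sum_k hatn R k * f (jb - J + j)%N k))).
    rewrite !mulr_sumr; apply: ler_sum => j _.
    have [jj1 _] := idx j (ltn_ord j).
    rewrite [leRHS]mulrCA [leLHS]mulrCA ler_wpM2l ?(ltW d0) // [leRHS]mulrCA ler_wpM2l //.
    by apply: sumB => k; have /andP[] := ff _ k jj1.
  rewrite ler_wpM2l ?exprn_ge0 //; apply: le_trans fmass.
  pose G j := d * (h ^+ n * \sum_k hatn R k * f j k).
  have G0 j : (jl <= j < jh)%N -> 0 <= G j.
    move=> jj; rewrite /G !mulr_ge0 ?(ltW d0) //; apply: sumr_ge0 => k _.
    by rewrite mulr_ge0 ?hatn_ge0 //; have /andP[] := ff j k jj.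
  rewrite -/(G _).
  (* The steps used form a subinterval of the whole time range, and all terms are nonnegative. *)
  have -> : \sum_(j < J) G (jb - J + j)%N = \sum_(jb - J <= j < jb) G j.
    rewrite -[in RHS](add0n (jb - J)%N) big_addn subKn // big_mkord.
    by apply: eq_bigr => j _; rewrite addnC.
  have l1 : (jl <= jb - J)%N by move: Jb Jjb jlb; clear; lia.
  rewrite (@big_cat_nat _ _ _ (jb - J)%N jl jh) //=; last by apply: leq_trans jbh; rewrite leq_subr.
  rewrite [in leRHS](@big_cat_nat _ _ _ jb (jb - J)%N jh) ?leq_subr //=.
  rewrite addrCA lerDl addr_ge0 // big_nat_cond sumr_ge0 // => j.
    by rewrite andbT => jj; apply: G0; move: jj jbh; clear; lia.
  by rewrite andbT => jj; apply: G0; move: jj jlb; clear; lia.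
have Jd1 : J%:R * d <= 1.
  by apply: le_trans jbd1; rewrite ler_wpM2r ?(ltW d0) // ler_nat.
rewrite yE in JH; rewrite zE in rc.
apply: (@final_contradiction R n A n0 A0 ub nu h d (\sum_(k | B k) U (jb - J)%N k)
  (\sum_(j < J) d * \sum_(k | B k) f (jb - J + j)%N k) J%:R r0%:R ub1 nu0 nun h0) => //.
by rewrite mulr_ge0 // ltW.
by rewrite -/K -rhoE -/g -yE -/c -zE.
Qed.

(** * Passage to the continuum *)

Lemma compact_upper_bound (R : realType) (T : topologicalType) (K : set T) (G : T -> R) :
  compact K -> (forall p, K p -> {for p, continuous G}) ->
  exists2 M, 0 < M & forall p, K p -> G p <= M.
Proof.
move=> /compact_near_coveringP cK cG.
have H : \forall M \near +oo, K `<=` (fun p => G p <= M).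
  apply: (cK _ +oo (fun M p => G p <= M)) => p Kp.
  have /cvgrPdist_lt/(_ _ ltr01) Gp := cG p Kp.
  exists ([set p' | `|G p - G p'| < 1], [set M | G p + 1 <= M]) => /=.
    by split => //; apply: nbhs_pinfty_ge; exact: num_real.
  move=> [p' M] /= [H1 H2]; apply: le_trans H2.
  by move: H1; rewrite distrC ltr_norml; move=> /andP[_]; lra.
have [M [M0 HM]] : exists M : R, 0 < M /\ K `<=` (fun p => G p <= M).
  have : \forall M \near +oo, 0 < M /\ K `<=` (fun p => G p <= M).
    by apply: filterI H; apply: nbhs_pinfty_gt; exact: num_real.
  by move=> /filter_ex.
by exists M => // p; exact: HM.
Qed.

(** As [x <= a], the loss [c * d * x] is at most [c * d * a]: adding (c a + b) times time to the
    mass makes its increment at least [d * y]. *)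
Lemma drift_absorb (R : realFieldType) (x x' y d t c b a : R) :
  0 <= c -> 0 <= d -> x <= a -> (1 - c * d) * x + d * y - d * b <= x' ->
  x + (c * a + b) * (t * d) + d * y <= x' + (c * a + b) * ((t + 1) * d).
Proof.
move=> c0 d0 xa H; have := mulr_ge0 (mulr_ge0 c0 d0) (_ : 0 <= a - x).
by rewrite subr_ge0 => /(_ xa); lra.
Qed.

Section Local.
Variables (R : realType) (n : nat) (Omega : set 'rV[R]_n) (u : 'rV[R]_n * R -> R)
  (x0 : 'rV[R]_n) (L : R).
Hypotheses (n0 : (0 < n)%N) (hu : C21 (cylinder Omega) u)
  (hu0 : forall p, cylinder Omega p -> 0 <= u p)
  (hineq : forall p, cylinder Omega p ->
      0 <= partialt u p - laplacian u p <= (u p + 1) `^ (1 + 2 / n%:R))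
  (L0 : 0 < L) (cubeO : cube x0 (L / 2) `<=` Omega).

Definition spacing (N : nat) : R := L / 2 ^+ N.
Definition tstep (N : nat) : R := spacing N ^+ 2 / 4.

Local Notation grid N := {ffun 'I_n -> 'I_(2 ^ N).+1}.
Local Notation X N k := (pt x0 L (spacing N) k).

Definition ug N (j : nat) (k : grid N) : R := u (X N k, j%:R * tstep N).
Definition fg N (j : nat) (k : grid N) : R :=
  partialt u (X N k, j%:R * tstep N) - laplacian u (X N k, j%:R * tstep N).

Lemma spacing_gt0 N : 0 < spacing N.
Proof. by rewrite /spacing divr_gt0 // exprn_gt0. Qed.

Lemma spacingM N : spacing N * (2 ^ N)%:R = L.
Proof. by rewrite /spacing natrX divfK // expf_neq0. Qed.

Lemma tstep_gt0 N : 0 < tstep N.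
Proof. by rewrite /tstep divr_gt0 // exprn_gt0 // spacing_gt0. Qed.

(** The time [tstep i] has index 4 ^ (N - i) on grid [N], so time windows keep their exact endpoints
    under refinement. *)
Lemma tstepM i N : (i <= N)%N -> (4 ^ (N - i))%:R * tstep N = tstep i.
Proof.
move=> iN; rewrite /tstep /spacing natrX !expr_div_n -!exprM ![(_ * 2)%N]mulnC !exprM.
rewrite (_ : 2 ^+ 2 = 4); last by rewrite -natrX.
rewrite -{2}(subnK iN) exprD; field.
by rewrite !expf_neq0 // pnatr_eq0.
Qed.

Lemma spacing_small (e : R) : 0 < e -> exists i, forall N, (i <= N)%N -> spacing N <= e.
Proof.
move=> e0; exists (Num.bound `|L / e|) => N iN.
rewrite /spacing ler_pdivrMr ?exprn_gt0 // mulrC -ler_pdivrMr //.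
apply: le_trans (ler_norm _) _; apply: le_trans (ltW (archi_boundP (normr_ge0 _))) _.
rewrite -natrX ler_nat; apply: leq_trans iN _; apply: ltnW; exact: ltn_expl.
Qed.

Lemma tstep_small (e : R) : 0 < e -> exists i, forall N, (i <= N)%N -> tstep N <= e.
Proof.
move=> e0; have [i Hi] := spacing_small (e := Num.min 1 e) (ltac:(by rewrite lt_min ltr01)).
exists i => N /Hi; rewrite le_min => /andP[h1 he].
have h0 := spacing_gt0 N; rewrite /tstep; nra.
Qed.

Section Window.
Variables (i1 i N : nat).
Hypotheses (T1 : tstep i1 <= 2^-1) (i1i : (i1 <= i)%N) (iN : (i <= N)%N).

Lemma time_ge j : (4 ^ (N - i) <= j)%N -> tstep i <= j%:R * tstep N.
Proof. by move=> ij; rewrite -(tstepM iN) ler_pM2r ?tstep_gt0 // ler_nat. Qed.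

Lemma time_le j : (j <= 4 ^ (N - i1))%N -> j%:R * tstep N <= tstep i1.
Proof.
move=> ji; rewrite -(tstepM (leq_trans i1i iN)) ler_pM2r ?tstep_gt0 //.
by rewrite ler_nat.
Qed.

Lemma grid_window j (k : grid N) : (4 ^ (N - i) <= j <= 4 ^ (N - i1))%N ->
  (cube x0 (L / 2) `*` `[tstep i, tstep i1]) (X N k, j%:R * tstep N).
Proof.
move=> /andP[j1 j2]; split; first exact: pt_cube (spacing_gt0 N) (spacingM N) k.
by rewrite /= in_itv /= time_ge ?time_le.
Qed.

End Window.

Lemma window_cylinder i1 i : tstep i1 <= 2^-1 ->
  cube x0 (L / 2) `*` `[tstep i, tstep i1] `<=` cylinder Omega.
Proof.
move=> T1 [x t] [/= xc]; rewrite /= in_itv /= => /andP[t1 t2]; split => /=.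
  exact: cubeO.
by rewrite in_itv /=; have ts := tstep_gt0 i; apply/andP; split; lra.
Qed.

Lemma window_C21 i1 i : tstep i1 <= 2^-1 ->
  C21 (cube x0 (L / 2) `*` `[tstep i, tstep i1]) u.
Proof. by move=> T1 p /(window_cylinder T1) /hu. Qed.

Lemma window_bound i1 i : tstep i1 <= 2^-1 -> exists2 Um, 0 < Um &
  forall p, (cube x0 (L / 2) `*` `[tstep i, tstep i1]) p -> u p <= Um.
Proof.
move=> T1; apply: compact_upper_bound.
  by apply: compact_setX; [exact: compact_cube|exact: segment_compact].
by move=> p /(window_C21 T1)[].
Qed.

Lemma window_consistency i1 i (e : R) : tstep i1 <= 2^-1 -> (i1 <= i)%N -> 0 < e ->
  exists N0, forall N, (N0 <= N)%N -> (i <= N)%N /\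
    forall j (k : grid N), (4 ^ (N - i) <= j < 4 ^ (N - i1))%N -> inside k ->
    `|ug j.+1 k - mean (@ug N j) k - tstep N * fg j k| <= tstep N * e.
Proof.
move=> T1 i1i e0.
have [eta eta0 H] := parabolic_consistency e0 (@window_C21 i1 i T1).
have eta20 : 0 < eta / 2 by rewrite divr_gt0.
have [N1 HN1] := spacing_small eta20.
exists (maxn N1 i) => N; rewrite geq_max => /andP[N1N iN]; split=> // j k /andP[j1 j2] ik.
have := H (spacing N) (2 ^ N)%N (j%:R * tstep N) (spacing_gt0 N) (spacingM N).
rewrite -/(tstep N) /ug /fg -[j.+1%:R]natr1 mulrDl mul1r; apply => //.
- by apply: le_lt_trans (HN1 _ N1N) _; rewrite ltr_pdivrMr //; lra.
- exact: time_ge.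
- by have := time_le i1i iN j2; rewrite -natr1 mulrDl mul1r.
Qed.

(** Riemann sums in space of the cutoff times u, and of the cutoff times u_t - Delta u. *)
Definition gmass N j : R := spacing N ^+ n * \sum_(k : grid N) hatn R k * ug j k.
Definition gflux N j : R := spacing N ^+ n * \sum_(k : grid N) hatn R k * fg j k.

(** Masses are bounded backwards from time [tstep i1], where u is bounded. A corrected mass is then
    monotone in time, and the pigeonhole on its drop bounds the flux between [tstep i] and
    [tstep i0] on arbitrarily fine grids. *)
Lemma mass_control : exists i1 A, [/\ tstep i1 <= 2^-1, 0 <= A &
  forall e, 0 < e -> exists2 i0, (i1 <= i0)%N & forall i, (i0 <= i)%N ->
    forall N0, exists N, [/\ (N0 <= N)%N, (i <= N)%N,
      forall j, (4 ^ (N - i) <= j <= 4 ^ (N - i1))%N -> gmass N j <= A &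
      \sum_(4 ^ (N - i) <= j < 4 ^ (N - i0)) tstep N * gflux N j <= e]].
Proof.
(* Turns the relative loss 5 n / 4 ^ N of one step into [C2 * tstep N]. *)
pose C2 : R := 20 * n%:R / L ^+ 2.
have C20 : 0 < C2 by rewrite divr_gt0 ?exprn_gt0 ?mulr_gt0 // ltr0n.
(* The window is so short that the total relative loss is at most 1/2, as [seq_decay_bound]
   requires. *)
have [i1 Hi1] := @tstep_small (Num.min 2^-1 (2^-1 / C2)) (ltac:(by rewrite lt_min invr_gt0 ltr0n /= divr_gt0 // invr_gt0)).
have := Hi1 _ (leqnn _); rewrite le_min => /andP[T1]; rewrite ler_pdivlMr // => TC2.
(* The cells of a grid have total volume (L + h) ^ n <= (2 L) ^ n. In [A] below, [B * U1] bounds the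
   last mass and [B] the accumulated errors. *)
pose B := (2 * L) ^+ n.
have B0 : 0 <= B by rewrite exprn_ge0 // mulr_ge0 // ltW.
have [U1 U10 HU1] := @window_bound i1 i1 T1.
pose A := 2 * (B * U1 + B).
have A0 : 0 <= A by rewrite mulr_ge0 // addr_ge0 // mulr_ge0 // ltW.
exists i1, A; split => //.
pose C := C2 * A + B.
have C0 : 0 <= C by rewrite addr_ge0 // mulr_ge0 // ltW.
pose M N j := gmass N j + C * (j%:R * tstep N).
have main i : (i1 <= i)%N -> exists N0, forall N, (N0 <= N)%N -> [/\ (i <= N)%N,
    forall j, (4 ^ (N - i) <= j <= 4 ^ (N - i1))%N -> 0 <= gmass N j <= A &
    forall j, (4 ^ (N - i) <= j < 4 ^ (N - i1))%N ->
      M N j + tstep N * gflux N j <= M N j.+1 /\ 0 <= gflux N j].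
  move=> i1i; have [N1 HN1] := window_consistency T1 i1i ltr01.
  exists (maxn N1 2) => N; rewrite geq_max => /andP[/HN1[iN cons] N2].
  have h0 := spacing_gt0 N; have d0 := tstep_gt0 N; have hm := spacingM N.
  have hn0 : 0 <= spacing N ^+ n by rewrite exprn_ge0 // ltW.
  have m1 : (1 <= 2 ^ N)%N by rewrite expn_gt0.
  have m5 : 5 <= (2 ^ N)%:R ^+ 2 :> R.
    rewrite -natrX ler_nat; apply: (@leq_trans ((2 ^ 2) ^ 2)) => //.
    by rewrite leq_sqr leq_exp2l.
  have hB : (spacing N * (2 ^ N).+1%:R) ^+ n <= B.
    rewrite -natr1 mulrDr mulr1 hm; apply: lerXn2r; rewrite ?nnegrE.
    - by rewrite addr_ge0 ?ltW.
    - by rewrite mulr_ge0 ?ltW.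
    - have : spacing N <= L by rewrite -[leRHS]hm ler_peMr ?(ltW h0) // ler1n.
      by lra.
  have U0 j (k : grid N) : (4 ^ (N - i) <= j <= 4 ^ (N - i1))%N -> 0 <= ug j k.
    by move=> jj; apply/hu0/(window_cylinder T1)/(grid_window i1i iN k jj).
  have f0 j (k : grid N) : (4 ^ (N - i) <= j < 4 ^ (N - i1))%N -> 0 <= fg j k.
    move=> /andP[j1 j2]; have jj : (4 ^ (N - i) <= j <= 4 ^ (N - i1))%N by rewrite j1 ltnW.
    by have /andP[] := hineq (window_cylinder T1 (grid_window i1i iN k jj)).
  have mass0 j : (4 ^ (N - i) <= j <= 4 ^ (N - i1))%N -> 0 <= gmass N j.
    move=> jj; rewrite mulr_ge0 // sumr_ge0 // => k _.
    by rewrite mulr_ge0 ?hatn_ge0 ?U0.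
  have flux0 j : (4 ^ (N - i) <= j < 4 ^ (N - i1))%N -> 0 <= gflux N j.
    move=> jj; rewrite mulr_ge0 // sumr_ge0 // => k _.
    by rewrite mulr_ge0 ?hatn_ge0 ?f0.
  have cC2 : n%:R * (5 / (2 ^ N)%:R ^+ 2) = C2 * tstep N.
    have p0 : 2 ^+ N != 0 :> R by rewrite expf_neq0.
    rewrite /C2 /tstep /spacing natrX; move: (2 ^+ N) p0 => p p0; field.
    by rewrite p0 gt_eqF.
  have step j : (4 ^ (N - i) <= j < 4 ^ (N - i1))%N ->
      (1 - C2 * tstep N) * gmass N j + tstep N * gflux N j - tstep N * B <= gmass N j.+1.
    move=> jj; have /andP[j1 j2] := jj.
    have jj' : (4 ^ (N - i) <= j <= 4 ^ (N - i1))%N by rewrite j1 ltnW.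
    have := @mass_step R n (2 ^ N) (@ug N j) (@ug N j.+1) (@fg N j) (spacing N) (tstep N) 1 B
      (ltW h0) (ltW d0) ler01 m5 (fun k => U0 j k jj') _ hB.
    rewrite cC2 mulr1; apply => k ik.
    by have := cons j k jj ik; rewrite ler_norml => /andP[H _]; lra.
  have mass_le j : (4 ^ (N - i) <= j <= 4 ^ (N - i1))%N -> gmass N j <= A.
    have pow : (4 ^ (N - i) <= 4 ^ (N - i1))%N by rewrite leq_exp2l // leq_sub2l.
    pose q := (4 ^ (N - i1) - 4 ^ (N - i))%N.
    have qE : (4 ^ (N - i) + q = 4 ^ (N - i1))%N by rewrite subnKC.
    have qd : q%:R * tstep N <= tstep i1.
      by apply: (time_le i1i iN); rewrite /q leq_subr.
    have qc : q%:R * (C2 * tstep N) <= 2^-1.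
      by rewrite mulrCA; apply: le_trans TC2; rewrite mulrC ler_pM2r.
    have e0 : 0 <= tstep N * B by rewrite mulr_ge0 // ltW.
    have c0 : 0 <= C2 * tstep N by rewrite mulr_ge0 // ltW.
    move=> jj; rewrite -qE in jj.
    apply: le_trans (@seq_decay_bound R (gmass N) _ _ _ _ c0 e0 qc _ _ j jj) _.
    - move=> j' jj'; rewrite qE in jj'; apply: le_trans (step j' jj').
      by rewrite lerD2r lerDl mulr_ge0 ?flux0 // ltW.
    - by move=> j' jj'; apply: mass0; rewrite -qE.
    rewrite qE /A ler_pM2l // lerD //.
      have jlast : (4 ^ (N - i1) <= 4 ^ (N - i1) <= 4 ^ (N - i1))%N by rewrite leqnn.
      apply: (@le_trans _ _ (spacing N ^+ n * \sum_(k : grid N) U1)).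
        rewrite ler_wpM2l //; apply: ler_sum => k _.
        have Hu : ug (4 ^ (N - i1)) k <= U1.
          apply: HU1; apply: grid_window => //; exact: leq_trans iN.
        have u0 : 0 <= ug (4 ^ (N - i1)) k by apply: U0; rewrite pow leqnn.
        by apply: le_trans Hu; rewrite ler_piMl ?hatn_le1.
      rewrite sumr_const card_ffun !card_ord -[U1 *+ _]mulr_natl mulrA ler_wpM2r ?(ltW U10) //.
      by rewrite natrX -exprMn.
    rewrite mulrA ler_piMl //; apply: le_trans qd _; lra.
  split => // j jj; first by rewrite mass0 ?mass_le.
  have /andP[j1 j2] := jj.
  have jj' : (4 ^ (N - i) <= j <= 4 ^ (N - i1))%N by rewrite j1 ltnW.
  split; last exact: flux0.
  rewrite /M /C -[j.+1%:R]natr1.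
  exact: (drift_absorb j%:R (ltW C20) (ltW (tstep_gt0 N)) (mass_le j jj') (step j jj)).
move=> e e0.
have [|i0 i10 Hi0] := @oscillation_pigeonhole R (fun i N => M N (4 ^ (N - i))%N) i1 (A + C) e e0.
  move=> i i1i; have [N0 HN0] := main i i1i; exists N0 => N /HN0[iN Hm _].
  have pow : (4 ^ (N - i) <= 4 ^ (N - i) <= 4 ^ (N - i1))%N.
    by rewrite leqnn leq_exp2l // leq_sub2l.
  have /andP[m0 mA] := Hm _ pow.
  have t1 : (4 ^ (N - i))%:R * tstep N <= 1.
    by case/andP: pow => _ /(time_le i1i iN); lra.
  have t0 : 0 <= (4 ^ (N - i))%:R * tstep N by rewrite mulr_ge0 // ltW // tstep_gt0.
  apply/andP; split; first exact: addr_ge0 m0 (mulr_ge0 C0 t0).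
  by apply: lerD => //; exact: ler_piMr.
exists i0 => // i i0i N0.
have i1i := leq_trans i10 i0i.
have [N1 HN1] := main i i1i.
have [N] := Hi0 i i0i (maxn N0 N1); rewrite geq_max => /andP[N0N /HN1[iN Hm HM]] osc.
exists N; split => //; first by move=> j /Hm /andP[].
apply: le_trans osc.
have pow : (4 ^ (N - i) <= 4 ^ (N - i0))%N by rewrite leq_exp2l // leq_sub2l.
have pow1 : (4 ^ (N - i0) <= 4 ^ (N - i1))%N by rewrite leq_exp2l // leq_sub2l.
rewrite -(telescope_sumr (M N) pow); apply: ler_sum_nat => j /andP[j1 j2].
have [|H _] := HM j; first by rewrite j1 (leq_trans j2).
by rewrite lerBrDr addrC.
Qed.

Lemma cube_grid_approx N x : cube x0 (L / 2) x -> exists k : grid N,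
  `|x - X N k| <= spacing N.
Proof.
move=> xc; have h0 := spacing_gt0 N.
exists [ffun l => inord (Num.truncn ((x 0 l - x0 0 l + L / 2) / spacing N))].
apply/rv_normP => [|l]; first exact: ltW.
have := xc l; rewrite /= in_itv /= => /andP[x1 x2].
set y := x 0 l - x0 0 l + L / 2.
have y0 : 0 <= y by rewrite /y; lra.
have yL : y <= L by rewrite /y; lra.
have /andP[H1 H2] := truncn_itv (divr_ge0 y0 (ltW h0)).
rewrite ler_pdivlMr // in H1; rewrite ltr_pdivrMr // -natr1 mulrDl mul1r in H2.
have Hk : (Num.truncn (y / spacing N) < (2 ^ N).+1)%N.
  rewrite ltnS -(ler_nat R) -(ler_pM2r h0); apply: le_trans H1 _.
  by rewrite mulrC spacingM.
rewrite !mxE ffunE -/y inordK //; move: H1 H2; rewrite mulrC; move: (spacing N * _) => a H1 H2.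
by rewrite ler_norml; apply/andP; split; move: H1 H2; rewrite /y; lra.
Qed.

(** The grid bound is applied at a grid point near (x, t), whose parabolic distance is at least sqrt
    t / 2, and passes to (x, t) by continuity. The initial time and the grid depend on the point,
    the constant does not. *)
Lemma local_blowup_rate : exists C T, 0 < T /\
  forall x t, `|x - x0| <= L / 8 -> 0 < t < T -> u (x, t) <= C * t `^ (- (n%:R / 2)).
Proof.
have [i1 [A [T1 A0 HA]]] := mass_control.
have [i0 i10 Hi0] := HA _ (small_mass_gt0 R n).
pose Lam := blowup_const n A.
have L264 : 0 < L ^+ 2 / 64 by rewrite divr_gt0 // exprn_gt0.
(* The bound L ^ 2 / 64 on t makes sqrt t / 2 at most L / 16, the spatial distance available. *)
exists ((2 * Lam) ^+ n), (Num.min (tstep i0) (L ^+ 2 / 64)); split.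
  by rewrite lt_min tstep_gt0.
move=> x t xx /andP[t0]; rewrite lt_min => /andP[tT tL].
have t40 : 0 < t / 4 by rewrite divr_gt0.
have [i2 Hi2] := tstep_small t40.
pose i := maxn i0 i2; have i0i : (i0 <= i)%N by rewrite leq_maxl.
have it4 : tstep i <= t / 4 by apply: Hi2; rewrite leq_maxr.
have i1i := leq_trans i10 i0i.
pose s := Num.sqrt t / 2.
have s0 : 0 < s by rewrite divr_gt0 // sqrtr_gt0.
have s2 : s ^+ 2 = t / 4 by rewrite /s expr_div_n sqr_sqrtr ?ltW // -natrX.
have sL : s <= L / 16.
  rewrite -ler_sqr ?nnegrE ?ltW //; last by rewrite divr_gt0.
  by rewrite s2; lra.
have ti0 : tstep i0 <= tstep i1.
  by rewrite -(tstepM i10) ler_peMl ?(ltW (tstep_gt0 _)) // ler1n expn_gt0.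
have xc : cube x0 (L / 2) x.
  apply/cubeP; first by rewrite divr_ge0 // ltW.
  by apply: le_trans xx _; rewrite ler_pM2l // lef_pV2 ?posrE // ler_nat.
have xtO : cylinder Omega (x, t).
  apply: (@window_cylinder i1 i T1); split => //=.
  by rewrite in_itv /=; apply/andP; split; lra.
suff H : u (x, t) <= Lam ^+ n / s ^+ n.
  have tn : t `^ (- (n%:R / 2)) = (Num.sqrt t ^+ n)^-1.
    rewrite powRN [n%:R / 2]mulrC powRrM powR12_sqrt ?(ltW t0) //.
    by rewrite powR_mulrn // sqrtr_ge0.
  apply: le_trans H _; rewrite tn /s expr_div_n [(2 * Lam) ^+ n]exprMn le_eqVlt; apply/orP; left.
  by apply/eqP; rewrite invf_div mulrA [_ * 2 ^+ n]mulrC.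
apply/ler_addgt0Pr => e e0.
have [Um Um0 HUm] := @window_bound i1 i T1.
have [uc _ _ _] := hu xtO.
move: (uc) => /cvgrPdist_lt/(_ _ e0)/nbhs_ballP[r /= r0 Hr].
have e80 : 0 < 8^-1 :> R by rewrite invr_gt0.
have [N1 HN1] := window_consistency T1 i1i e80.
have rr0 : 0 < radius_ratio n A.
  by apply: lt_le_trans (horizon_le_radius n0 A0); apply: lt_le_trans (horizon_ratio_ge1 A0).
(* The three bounds serve the spatial distance, the mesh condition of the grid bound, and the ball
   given by continuity. *)
have [N2 HN2] := @spacing_small (Num.min (L / 16) (Num.min (radius_ratio n A / Um) (r / 2)))
  (ltac:(by rewrite !lt_min !divr_gt0)).
have [N3 HN3] := @tstep_small (Num.min (t / 4) (r / 2)) (ltac:(by rewrite !lt_min !divr_gt0)).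
have [N [N0N iN Hm Hf]] := Hi0 i i0i (maxn N1 (maxn N2 N3)).
move: N0N; rewrite !geq_max => /and3P[/HN1[_ cons] /HN2 + /HN3].
rewrite !le_min => /and3P[h1 h2 h3] /andP[d1 d2].
have h0 := spacing_gt0 N; have d0 := tstep_gt0 N.
have [k xk] := cube_grid_approx N xc.
have /andP[j1 j2] := truncn_itv (divr_ge0 (ltW t0) (ltW d0)).
move: j1 j2; set j := Num.truncn _.
rewrite ler_pdivlMr // ltr_pdivrMr // -natr1 mulrDl mul1r => j1 j2.
have jl : (4 ^ (N - i) <= j)%N.
  by rewrite -(ler_nat R) -(ler_pM2r d0) (tstepM iN); lra.
have jh : (j <= 4 ^ (N - i0))%N.
  rewrite -(ler_nat R) -(ler_pM2r d0) (tstepM (leq_trans i0i iN)).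
  by apply: le_trans j1 _; exact: ltW.
have pow1 : (4 ^ (N - i0) <= 4 ^ (N - i1))%N by rewrite leq_exp2l // leq_sub2l.
have win j' : (4 ^ (N - i) <= j' <= 4 ^ (N - i0))%N -> (4 ^ (N - i) <= j' <= 4 ^ (N - i1))%N.
  by move=> /andP[-> /leq_trans]; exact.
have winl j' : (4 ^ (N - i) <= j' < 4 ^ (N - i0))%N -> (4 ^ (N - i) <= j' < 4 ^ (N - i1))%N.
  by move=> /andP[-> /leq_trans]; exact.
have inK j' (k' : grid N) (jj : (4 ^ (N - i) <= j' <= 4 ^ (N - i0))%N) :=
  grid_window i1i iN k' (win _ jj).
have GB := @grid_blowup_bound R n A x0 L (spacing N) (tstep N) (tstep i) Um (2 ^ N)
  (4 ^ (N - i)) (4 ^ (N - i0)) (@ug N) (@fg N) n0 A0 _ h0 (spacingM N) erefl (tstepM iN)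
  (ltW (tstep_gt0 i)).
have {}GB : bdist x0 L (tstep i) (X N k) (j%:R * tstep N) ^+ n * ug j k <= Lam ^+ n.
  apply: GB.
  - by rewrite expn_gt0.
  - by rewrite (tstepM (leq_trans i0i iN)); lra.
  - move=> j' k' jj; apply/andP; split; last exact: HUm (inK _ _ jj).
    exact: hu0 (window_cylinder T1 (inK _ _ jj)).
  - by rewrite -ler_pdivlMr.
  - move=> j' k' /andP[a b]; apply: hineq; apply: (window_cylinder T1); apply: inK.
    by rewrite a ltnW.
  - move=> j' k' jj ik; have := cons j' k' (winl _ jj) ik.
    by rewrite ler_norml => /andP[_]; lra.
  - by move=> j' jj; apply: Hm; exact: win.
  - exact: Hf.
  - by rewrite jl.
(* In time, t - t/4 - t/4 >= s ^ 2; in space, L/4 - L/8 - L/16 >= s. *)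
have Hbd : s <= bdist x0 L (tstep i) (X N k) (j%:R * tstep N).
  rewrite /bdist le_max le_min; apply/orP; right; apply/andP; split.
    have : s ^+ 2 <= j%:R * tstep N - tstep i by rewrite s2; lra.
    by move=> /ler_wsqrtr; rewrite sqrtr_sqr; apply: le_trans; exact: ler_norm.
  have := ler_normB (x - x0) (x - X N k).
  by rewrite opprB addrC addrA subrK => H; lra.
have Us : ug j k <= Lam ^+ n / s ^+ n.
  rewrite ler_pdivlMr ?exprn_gt0 // mulrC; apply: le_trans GB.
  have U0 : 0 <= ug j k by apply/hu0/(window_cylinder T1)/inK; rewrite jl.
  rewrite ler_wpM2r //; apply: lerXn2r => //; rewrite nnegrE; first exact: ltW.
  by apply: le_trans Hbd; exact: ltW.
have : `|u (x, t) - ug j k| < e.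
  apply: Hr; rewrite -ball_normE /=.
  have -> : (x, t) - (X N k, j%:R * tstep N) = (x - X N k, t - j%:R * tstep N) by [].
  rewrite prod_normE gt_max /=; apply/andP; split.
    by apply: le_lt_trans xk _; lra.
  by rewrite ger0_norm; lra.
by rewrite ltr_norml => /andP[_ H]; lra.
Qed.

End Local.

(** * From small balls to compact sets *)

Theorem theorem1p1 (R : realType) (n : nat) (hn : (1 <= n)%N)
    (Omega : set 'rV[R]_n) (hOmega : open Omega)
    (u : 'rV[R]_n * R -> R)
    (hu : C21 (cylinder Omega) u)
    (hu0 : forall p, cylinder Omega p -> 0 <= u p)
    (hineq : forall p, cylinder Omega p ->
      0 <= partialt u p - laplacian u p <= (u p + 1) `^ (1 + 2 / n%:R))
    (K : set 'rV[R]_n) (hK : compact K) (hKOmega : K `<=` Omega) :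
  spatial_max K u =O_ (0^'+) (fun t : R => t `^ (- (n%:R / 2))).
Proof.
(* The constant tends to infinity and the time to 0 along a product filter, so that compactness
   makes the local bounds uniform over [K]. *)
have cover : \forall i \near filter_prod (+oo : set_system R) (0 : R)^'+,
    K `<=` (fun x => u (x, i.2) <= i.1 * i.2 `^ (- (n%:R / 2))).
  move/compact_near_coveringP: hK.
  move=> /(_ _ (filter_prod (+oo : set_system R) (0 : R)^'+)
            (fun i x => u (x, i.2) <= i.1 * i.2 `^ (- (n%:R / 2)))); apply.
  move=> x Kx.
  have := hOmega; rewrite openE => /(_ x (hKOmega x Kx)) /nbhs_ballP[L /= L0 HL].
  have cO : cube x (L / 2) `<=` Omega.
    move=> y /(cubeP _ _ (ltW (divr_gt0 L0 (ltr0Sn R 1)))) yx; apply: HL.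
    rewrite -ball_normE /= distrC; apply: le_lt_trans yx _.
    by rewrite ltr_pdivrMr //; lra.
  have [C [T [T0 HCT]]] := local_blowup_rate hn hu hu0 hineq L0 cO.
  exists (ball x (L / 8), [set i | C <= i.1 /\ 0 < i.2 < T]) => /=.
    split; first by apply: nbhsx_ballx; rewrite divr_gt0.
    exists ([set c | C <= c], [set t | 0 < t < T]) => /=.
      split; first by apply: nbhs_pinfty_ge; exact: num_real.
      near=> t; apply/andP; split; near: t; [exact: nbhs_right_gt|exact: nbhs_right_lt].
    by move=> [c t] [].
  move=> [x' [c t]] /= [xx' [Cc tT]].
  apply: le_trans (HCT x' t _ tT) _.
    by move: xx'; rewrite -ball_normE /= distrC => /ltW.
  by rewrite ler_wpM2r // powR_ge0.
case: cover => -[P Q] /= [HP HQ] PQ.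
apply/eqOP; near=> c; near=> t.
have Pc : P c by near: c.
have c0 : 0 <= c by near: c; apply: nbhs_pinfty_ge; exact: num_real.
have Qt : Q t by near: t.
have t01 : 0 < t < 1.
  by apply/andP; split; near: t; [exact: nbhs_right_gt|exact: nbhs_right_lt].
(* For empty [K] the supremum is 0 by convention. *)
have [->|/set0P K0] := eqVneq K set0.
  by rewrite /spatial_max image_set0 sup0 normr0 mulr_ge0.
have [x Kx [<- _]] := spatial_maxP hu hK hKOmega K0 t01.
rewrite ger0_norm; last first.
  by apply: hu0; split; [exact: hKOmega|rewrite /= in_itv].
rewrite [`|_ `^ _|]ger0_norm ?powR_ge0 //.
exact: (PQ (c, t) (conj Pc Qt) x Kx).
Unshelve. all: by end_near.
Qed.
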